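(* For every $n\ge1$, the function $H_n(t)$, $t\in(0,1)$, satisfies \begin{align*} &t^2(t-1)^2(H_n'')^2+4t(t-1)(H_n')^3-\Big\{4(2t-1)H_n+[4n^2+4n(\alpha+\beta+\gamma)+(\alpha+\beta)^2]t^2\\ &\quad-2[2n^2+2n(\alpha+\beta+\gamma)+\alpha(\alpha+\gamma)+\beta(\alpha-\gamma)]t+(\alpha+\gamma)^2\Big\}(H_n')^2\\ &+2\Big\{2H_n^2+\big[(4n^2+4n(\alpha+\beta+\gamma)+(\alpha+\beta)^2)t-2n^2-2n(\alpha+\beta+\gamma)-\alpha(\alpha+\gamma)-\beta(\alpha-\gamma)\big]H_n\\ &\quad-n\gamma(n+\alpha+\beta+\gamma)[(\alpha-\beta)t-\alpha-\gamma]\Big\}H_n'-[4n^2+4n(\alpha+\beta+\gamma)+(\alpha+\beta)^2]H_n^2\\ &+2n\gamma(\alpha-\beta)(n+\alpha+\beta+\gamma)H_n-n^2\gamma^2(n+\alpha+\beta+\gamma)^2=0. \end{align*}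
   Context: Fix $\alpha,\beta,\gamma>0$ and real constants $A,B$ with $A\ge0$, $A+B\ge0$, not both $A$ and $A+B$ equal to $0$. Let $\theta$ be the Heaviside function ($\theta(x)=1$ for $x>0$, $0$ otherwise). For $t\in(0,1)$ put $w(x,t)=x^{\alpha}(1-x)^{\beta}|x-t|^{\gamma}(A+B\theta(x-t))$ on $[0,1]$, let $D_n(t)=\det\left(\int_0^1x^{i+j}w(x,t)dx\right)_{i,j=0}^{n-1}$, and $H_n(t)=t(t-1)\frac{d}{dt}\ln D_n(t)$. *)

(* Defs.v *)
From Stdlib Require Import Reals Lra Lia Classical ClassicalEpsilon.
Open Scope R_scope.

(* real power x^a for x > 0, extended by 0 for x <= 0 (the paper's x^a for a > 0) *)
Definition rpow (x a : R) : R := if Rlt_dec 0 x then Rpower x a else 0.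

Definition theta (x : R) : R := if Rlt_dec 0 x then 1 else 0.

Definition weight (alpha beta gamma A B t x : R) : R :=
  rpow x alpha * rpow (1 - x) beta * rpow (Rabs (x - t)) gamma * (A + B * theta (x - t)).

(* Riemann integral over [0,1] (0 if f is not Riemann integrable, which does
   not happen for the integrands used here) *)
Definition integral01 (f : R -> R) : R :=
  match excluded_middle_informative
          (exists I : R, exists pr : Riemann_integrable f 0 1, RiemannInt pr = I) with
  | left h => proj1_sig (constructive_indefinite_description _ h)
  | right _ => 0
  end.

Fixpoint detn (n : nat) (M : nat -> nat -> R) : R :=
  match n with
  | O => 1
  | S m => sum_f_R0 (fun j => (-1) ^ j * M O j *
             detn m (fun i k => M (S i) (if Nat.ltb k j then k else S k))) m
  end.

Definition moment (alpha beta gamma A B t : R) (k : nat) : R :=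
  integral01 (fun x => x ^ k * weight alpha beta gamma A B t x).

Definition Dn (alpha beta gamma A B : R) (n : nat) (t : R) : R :=
  detn n (fun i j => moment alpha beta gamma A B t (i + j)).

(* Main.v *)
(* Let P_n = x^n + p_n x^(n-1) + ... be the monic orthogonal polynomials of the
   weight w and h_n their squared norms.  The Pearson equation
   (x (1-x) (x-t) w)' = tau w gives a recurrence for the moments and, since
   multiplying w by x - t makes it differentiable in t, a formula for their
   t-derivatives.  Hence t (1-t) h_n' / h_n and t (1-t) p_n' are polynomials in
   the recurrence coefficients, and t (1-t) (ln D_n)' telescopes to an affine
   function of p_n.

   The vector (P_n, P_(n-1)) satisfies x (1-x) (x-t) Phi' = M Phi with an
   explicit polynomial matrix M of trace -x (1-x) (x-t) w' / w.  At x = 0, 1, t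
   the left side vanishes while Phi does not, so det M = 0 there.  Two of these
   three equations express b = h_n / h_(n-1) and a linear combination of
   b h_n' / h_n and b h_(n-1)' / h_(n-1) in terms of p_n and p_n'; a second
   combination is b', obtained by differentiating the first expression.  The
   third equation, for the product h_n' h_(n-1)', then becomes a second order
   equation for p_n: it is the sigma form. *)

Require Import Defs.
From Stdlib Require Import Reals Lra ClassicalEpsilon FunctionalExtensionality.
From mathcomp Require all_boot all_order all_algebra ring Rstruct.
From Coquelicot Require Coquelicot.
Open Scope R_scope.

(** * Semiclassical orthogonal polynomials and their Lax matrix *)

Module OrthoPoly.
Import all_boot all_order all_algebra ring.
Import GRing.Theory.
Local Open Scope ring_scope.
Set Implicit Arguments.
Unset Strict Implicit.
Unset Printing Implicit Defensive.

(** * Moment functionals and monic orthogonal polynomials *)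

Section Functional.
Variables (F : fieldType) (mu : nat -> F).
Implicit Types G K : {poly F}.

Definition mom_fun G : F := \sum_(i < size G) G`_i * mu i.
Local Notation L := mom_fun.

Lemma mom_fun_wide n G : (size G <= n)%N -> L G = \sum_(i < n) G`_i * mu i.
Proof.
move=> sG; rewrite /L (big_ord_widen n (fun i => G`_i * mu i) sG) big_mkcond /=.
apply: eq_bigr => i _; case: ltnP => // leGi.
by rewrite nth_default // mul0r.
Qed.

Lemma mom_fun_comb u v G K : L (u *: G + v *: K) = u * L G + v * L K.
Proof.
pose n := maxn (size G) (size K).
have sG : (size G <= n)%N by rewrite leq_maxl.
have sK : (size K <= n)%N by rewrite leq_maxr.
have s : (size (u *: G + v *: K)%R <= n)%N.
  rewrite (leq_trans (size_polyD _ _)) // geq_max.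
  by rewrite !(leq_trans (size_scale_leq _ _)).
rewrite (mom_fun_wide sG) (mom_fun_wide sK) (mom_fun_wide s).
rewrite !mulr_sumr -big_split /=; apply: eq_bigr => i _.
by rewrite coefD !coefZ mulrDl !mulrA.
Qed.

Lemma mom_funD G K : L (G + K) = L G + L K.
Proof. by have := mom_fun_comb 1 1 G K; rewrite !scale1r !mul1r. Qed.
Lemma mom_funB G K : L (G - K) = L G - L K.
Proof. by have := mom_fun_comb 1 (-1) G K; rewrite !scale1r !mul1r scaleN1r mulN1r. Qed.
Lemma mom_funZ u G : L (u *: G) = u * L G.
Proof. by have := mom_fun_comb u 0 G 0; rewrite !scale0r !mul0r !addr0. Qed.
Lemma mom_fun0 : L 0 = 0.
Proof. by rewrite -(scale0r 0) mom_funZ mul0r. Qed.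
Lemma mom_funCM u G : L (u%:P * G) = u * L G.
Proof. by rewrite mul_polyC mom_funZ. Qed.
Lemma mom_funXn k : L 'X^k = mu k.
Proof.
rewrite /L size_polyXn big_ord_recr /= coefXn eqxx mul1r big1 ?add0r // => i _.
by rewrite coefXn ltn_eqF // mul0r.
Qed.

(** Identities that are linear in a polynomial, such as the Pearson equation, then need checking on
    the powers of x only. *)
Lemma poly_ind_monomial (A : {poly F} -> Prop) :
  A 0 -> (forall u k G, A G -> A (u *: 'X^k + G)) -> forall G, A G.
Proof.
move=> A0 AS G; rewrite -[G]coefK poly_def.
by elim/big_rec: _ => // i x _ Ax; apply: AS.
Qed.

Lemma mom_fun_sum (I : Type) (r : seq I) (f : I -> {poly F}) :
  L (\sum_(i <- r) f i) = \sum_(i <- r) L (f i).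
Proof. by elim/big_rec2: _ => [|i y1 y2 _ <-]; rewrite ?mom_fun0 ?mom_funD. Qed.

Lemma poly_wide n G : (size G <= n)%N -> G = \sum_(i < n) G`_i *: 'X^i.
Proof.
move=> /leq_sizeP sG; rewrite -(poly_def n (fun i => G`_i)); apply/polyP => i.
by rewrite coef_poly; case: ltnP => // /sG.
Qed.

(** The Hankel form in the coefficients. A common width [n] keeps the range of summation fixed when
    G and K vary with t. *)
Lemma mom_fun_mul n G K : (size G <= n)%N -> (size K <= n)%N ->
  L (G * K) = \sum_(i < n) \sum_(j < n) G`_i * (K`_j * mu (i + j)).
Proof.
move=> sG sK; rewrite [in LHS](poly_wide sG) mulr_suml mom_fun_sum; apply: eq_bigr => i _.
rewrite [in LHS](poly_wide sK) mulr_sumr mom_fun_sum; apply: eq_bigr => j _.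
by rewrite -scalerAl -scalerAr !mom_funZ -exprD mom_funXn.
Qed.

Lemma theta_Xn k : 'X * ('X^k)^`() = k%:R%:P * 'X^k :> {poly F}.
Proof.
rewrite derivXn -mulr_natl polyC_natr mulrCA; case: k => [|k]; first by rewrite !mul0r.
by rewrite -exprS.
Qed.

(** The Stieltjes recurrence, run on (P_n, P_(n-1)) with P_(-1) = 0. At the first step the quotient
    by L (Q * Q) = 0 is 0 by the convention for inverses, so [rec_b 0] is 0. *)
Fixpoint ortho_pair n : {poly F} * {poly F} :=
  if n is m.+1 then
    let: (P, Q) := ortho_pair m in
    (('X - (L ('X * (P * P)) / L (P * P))%:P) * P - (L (P * P) / L (Q * Q))%:P * Q, P)
  else (1, 0).

Definition orthop n := (ortho_pair n).1.
Local Notation P := orthop.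
Definition sqnorm n := L (P n * P n).
Local Notation h := sqnorm.
Definition rec_a n := L ('X * (P n * P n)) / h n.
Definition rec_b n := h n / L ((ortho_pair n).2 * (ortho_pair n).2).

Lemma orthopS n : P n.+1 = ('X - (rec_a n)%:P) * P n - (rec_b n)%:P * (ortho_pair n).2.
Proof. by rewrite /rec_a /rec_b /h /P /=; case: (ortho_pair n). Qed.

Lemma ortho_pairS n : (ortho_pair n.+1).2 = P n.
Proof. by rewrite /P /=; case: (ortho_pair n). Qed.

Lemma rec_b0 : rec_b 0 = 0.
Proof. by rewrite /rec_b /= mul0r mom_fun0 invr0 mulr0. Qed.

Lemma rec_bS n : rec_b n.+1 = h n.+1 / h n.
Proof. by rewrite /rec_b ortho_pairS. Qed.

Lemma orthop0 : P 0 = 1. Proof. by []. Qed.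
Lemma orthop1 : P 1 = 'X - (rec_a 0)%:P.
Proof. by rewrite orthopS rec_b0 mul0r subr0 mulr1. Qed.
Lemma orthopSS n : P n.+2 = ('X - (rec_a n.+1)%:P) * P n.+1 - (rec_b n.+1)%:P * P n.
Proof. by rewrite orthopS ortho_pairS. Qed.

(** The coefficients of x^(n-1) and x^(n-2) in P_n, read off from the recurrence; [coef1 n] is
    p_n. *)
Fixpoint coef1 n : F := if n is m.+1 then coef1 m - rec_a m else 0.
Fixpoint coef2 n : F :=
  if n is m.+1 then coef2 m - rec_a m * coef1 m - rec_b m else 0.

(* Coefficients of degrees d, d - 1, d - 2; the shift by 'X^2 avoids truncated
   subtraction when [d < 2]. *)
Definition tops G d (x y z : F) :=
  [/\ (size G <= d.+1)%N, ('X^2 * G)`_d.+2 = x, ('X^2 * G)`_d.+1 = y & ('X^2 * G)`_d = z].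

Lemma tops_comb u v G K d x y z x' y' z' : tops G d x y z -> tops K d x' y' z' ->
  tops (u%:P * G + v%:P * K) d (u * x + v * x') (u * y + v * y') (u * z + v * z').
Proof.
move=> [sG <- <- <-] [sK <- <- <-].
have E : 'X^2 * (u%:P * G + v%:P * K) = u *: ('X^2 * G) + v *: ('X^2 * K).
  by rewrite -!mul_polyC; ring.
split; rewrite ?E ?coefD ?coefZ //.
rewrite (leq_trans (size_polyD _ _)) // geq_max !mul_polyC.
by rewrite !(leq_trans (size_scale_leq _ _)).
Qed.

Lemma topsX G d x y z : tops G d x y z -> tops ('X * G) d.+1 x y z.
Proof.
move=> [sG <- <- <-]; split.
- by rewrite (leq_trans (size_polyMleq _ _)) // size_polyX /= ltnS.
- by rewrite mulrCA coefXM.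
- by rewrite mulrCA coefXM.
- by rewrite mulrCA coefXM.
Qed.

Lemma tops_up G d x y z : tops G d x y z -> tops G d.+1 0 x y.
Proof.
move=> [sG <- <- _]; split=> //; first exact: leqW.
by rewrite coefXnM /= !subSS subn0 nth_default.
Qed.

(** The Euler operator x d/dx multiplies the coefficient of x^j by j; after the shift by 'X^2 the
    index j stands for degree j - 2. *)
Lemma tops_theta G d x y z : tops G d x y z ->
  tops ('X * G^`()) d (d%:R * x) ((d%:R - 1) * y) ((d%:R - 2%:R) * z).
Proof.
move=> [sG <- <- <-].
have c j : ('X^2 * ('X * G^`()))`_j = (j%:R - 2%:R) * ('X^2 * G)`_j.
  have -> : 'X^2 * ('X * G^`()) = 'X * ('X^2 * G)^`() - 2%:R *: ('X^2 * G).
    rewrite derivM derivXn /= -mul_polyC polyCMn; ring.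
  rewrite coefB coefZ coefXM coef_deriv; case: j => [|j] /=.
    by rewrite coefXnM /=; ring.
  by rewrite -mulr_natr; ring.
split; last 3 first.
- by rewrite c -[d.+2]addn2 natrD addrK.
- by rewrite c -[d.+1]addn1 natrD; ring.
- by rewrite c.
rewrite (leq_trans (size_polyMleq _ _)) // size_polyX /=.
have [->|G0] := eqVneq G 0; first by rewrite deriv0 size_poly0.
by rewrite (leq_trans (lt_size_deriv G0)).
Qed.

Definition quad (u v w : F) : {poly F} := u%:P * 'X^2 + v%:P * 'X + w%:P.

Lemma tops_quad u v w G d x y z : tops G d x y z ->
  tops (quad u v w * G) d.+2 (u * x) (u * y + v * x) (u * z + v * y + w * x).
Proof.
move=> tG.
have t2 := topsX (topsX tG).
have t1 := tops_up (topsX tG).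
have t0 := tops_up (tops_up tG).
have := tops_comb 1 w (tops_comb u v t2 t1) t0.
rewrite (_ : _ + w%:P * G = quad u v w * G); last by rewrite /quad; ring.
by congr tops; ring.
Qed.

Lemma tops_orthop n : tops (P n) n 1 (coef1 n) (coef2 n).
Proof.
suff: tops (P n) n 1 (coef1 n) (coef2 n) /\
      tops (P n.+1) n.+1 1 (coef1 n.+1) (coef2 n.+1) by case.
have t0 : tops (P 0) 0 1 (coef1 0) (coef2 0).
  by split; rewrite ?size_poly1 // orthop0 mulr1 coefXn.
elim: n => [|n [IH0 IH1]].
  split=> //; rewrite orthop1 /= rec_b0.
  have := tops_comb 1 (- rec_a 0) (topsX t0) (tops_up t0).
  rewrite orthop0 !mulr1 mul1r.
  rewrite (_ : _ + _ = 'X - (rec_a 0)%:P); last by ring.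
  by congr tops; rewrite /=; ring.
split=> //; rewrite orthopSS.
have t1 := tops_comb 1 (- rec_a n.+1) (topsX IH1) (tops_up IH1).
have := tops_comb 1 (- rec_b n.+1) t1 (tops_up (tops_up IH0)).
rewrite (_ : _ + _ = ('X - (rec_a n.+1)%:P) * P n.+1 - (rec_b n.+1)%:P * P n); last by ring.
by congr tops; rewrite /=; ring.
Qed.

Lemma tops0_size G n : tops G n.+2 0 0 0 -> (size G <= n)%N.
Proof.
move=> [/leq_sizeP sG c2 c1 c0]; apply/leq_sizeP => j nj.
move: c2 c1 c0; rewrite !coefXnM /= !subSS !subn0 => c2 c1 c0.
have [j3|] := leqP n.+3 j; first exact: sG.
rewrite ltnS leq_eqVlt => /predU1P[->//|]; rewrite ltnS leq_eqVlt => /predU1P[->//|].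
by rewrite ltnS => jn; rewrite (_ : j = n) //; apply/eqP; rewrite eqn_leq jn.
Qed.

Lemma size_orthop n : size (P n) = n.+1.
Proof.
apply/eqP; rewrite eqn_leq; have [-> c _ _] := tops_orthop n.
rewrite ltnNge; apply/negP => /leq_sizeP/(_ n (leqnn n)) c0.
move: c; rewrite coefXnM /= !subSS subn0 c0 => /esym/eqP; by rewrite oner_eq0.
Qed.

Lemma lead_orthop n : (P n)`_n = 1.
Proof. by have [_ <- _ _] := tops_orthop n; rewrite coefXnM /= !subSS subn0. Qed.

Lemma sublead_orthop n : (P n.+1)`_n = coef1 n.+1.
Proof. by have [_ _ <- _] := tops_orthop n.+1; rewrite coefXnM /= !subSS subn0. Qed.

Lemma orthop_reduce n G : (size G <= n.+1)%N -> (size (G - G`_n *: P n)%R <= n)%N.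
Proof.
move=> /leq_sizeP sG; apply/leq_sizeP => j.
rewrite leq_eqVlt => /predU1P[<-|nj]; rewrite coefB coefZ ?lead_orthop ?mulr1 ?subrr //.
have Pj : (P n)`_j = 0 by rewrite nth_default // size_orthop.
by rewrite Pj mulr0 subr0 sG.
Qed.

(** * Orthogonality, pairings from top coefficients, and the Hankel determinant *)

Hypothesis h_neq0 : forall n, h n != 0.

Lemma L_reduce n G K : L (K * G) = G`_n * L (K * P n) + L (K * (G - G`_n *: P n)).
Proof. by rewrite -mom_funZ -mom_funD; congr L; rewrite -!mul_polyC; ring. Qed.

(** Strong induction on the larger index, expanding P_(n+1) and x P_k by the recurrence. The choice
    of [rec_a] settles k = n, the choice of [rec_b] settles k = n - 1, and for smaller k every term
    vanishes by induction. *)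
Lemma orthop_orth m n : (m < n)%N -> L (P n * P m) = 0.
Proof.
elim/ltn_ind: n m => [[//|n]] IH k; rewrite ltnS => lekn.
have IH' k' n' : (k' <= n)%N -> (n' <= n)%N -> k' != n' -> L (P n' * P k') = 0.
  move=> k'n n'n; rewrite neq_ltn => /orP[] lt; first exact: IH.
  by rewrite mulrC; apply: IH.
have XP k' : 'X * P k' = P k'.+1 + (rec_a k')%:P * P k' + (rec_b k')%:P * (ortho_pair k').2.
  by rewrite orthopS; ring.
have -> : L (P n.+1 * P k) = L (P n * ('X * P k)) - rec_a n * L (P n * P k)
           - rec_b n * L ((ortho_pair n).2 * P k).
  by rewrite orthopS -!mom_funCM -!mom_funB; congr L; ring.
move: lekn; rewrite leq_eqVlt => /predU1P[->|].
  rewrite /rec_a mulrCA divfK ?h_neq0 // subrr add0r.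
  case: n {IH XP} IH' => [|n] IH'; first by rewrite rec_b0 mul0r oppr0.
  by rewrite ortho_pairS IH' ?mulr0 ?oppr0 // gtn_eqF.
case: n IH IH' => [//|n] IH IH'; rewrite ltnS => lekn.
rewrite ortho_pairS XP !mulrDr !mom_funD !(mulrCA _ _%:P) !mom_funCM.
rewrite (IH' k n.+1 (leqW lekn) (leqnn _)) ?(@ltn_eqF k n.+1) //.
have -> : rec_b k * L (P n.+1 * (ortho_pair k).2) = 0.
  case: k lekn => [|k] lekn; first by rewrite rec_b0 mul0r.
  by rewrite ortho_pairS (IH' k n.+1) ?mulr0 ?ltn_eqF // ?leqW // ltnW // ltnW.
move: lekn; rewrite leq_eqVlt => /predU1P[->|ltkn].
  by rewrite rec_bS divfK ?h_neq0 // !mulr0 !addr0 subr0 subrr.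
have nk1 : k.+1 != n.+1 by rewrite ltn_eqF.
have nk : k != n by rewrite ltn_eqF.
rewrite (IH' _ _ (leqW ltkn) (leqnn _) nk1) (IH' _ _ (leqW (ltnW ltkn)) (leqnSn _) nk).
by rewrite !mulr0 !addr0 !subr0.
Qed.

Lemma orthop_low n G : (size G <= n)%N -> L (P n * G) = 0.
Proof.
suff: forall k G, (size G <= k)%N -> (k <= n)%N -> L (P n * G) = 0.
  by move=> H sG; apply: H sG _.
elim=> [|k IH] {}G sG kn; first by move: sG; rewrite leqn0 size_poly_eq0 => /eqP->; rewrite mulr0 mom_fun0.
rewrite (L_reduce k) orthop_orth // mulr0 add0r; apply: IH; last exact: ltnW.
exact: orthop_reduce.
Qed.

(** Pairing with P_n reads off the top coefficient of G, so the degree drops one step at a time. *)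
Lemma orthop_nondeg n G : (size G <= n)%N ->
  (forall k, (k < n)%N -> L (G * P k) = 0) -> G = 0.
Proof.
elim: n => [|n IH] sG orth; first by apply/eqP; rewrite -size_poly_eq0 -leqn0.
have : L (G * P n) = G`_n * h n.
  rewrite -[G in LHS](subrK (G`_n *: P n)) mulrDl mom_funD -scalerAl mom_funZ.
  by rewrite mulrC orthop_low ?add0r // orthop_reduce.
rewrite orth // => /esym/eqP; rewrite mulf_eq0 (negPf (h_neq0 n)) orbF => /eqP Gn.
apply: IH => [|k kn]; last by apply: orth; apply: leqW.
by have := orthop_reduce sG; rewrite Gn scale0r subr0.
Qed.

(** Subtracting multiples of P_(n+2), P_(n+1) and P_n leaves a remainder of degree below n. Only the
    P_n term survives the pairing, so three top coefficients determine it. *)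
Lemma L_tops n G x y z : tops G n.+2 x y z ->
  L (P n * G) = (z - x * coef2 n.+2 - (y - x * coef1 n.+2) * coef1 n.+1) * h n.
Proof.
move=> tG; set y' := y - _; set z' := z - _ - _.
have t2 := tops_comb 1 (- x) tG (tops_orthop n.+2).
have t1 := tops_comb 1 (- y') t2 (tops_up (tops_orthop n.+1)).
have t0 := tops_comb 1 (- z') t1 (tops_up (tops_up (tops_orthop n))).
have sG : (size (1%:P * (1%:P * (1%:P * G + (- x)%:P * P n.+2) + (- y')%:P * P n.+1)
     + (- z')%:P * P n)%R <= n)%N.
  by apply: tops0_size; move: t0; congr tops; rewrite /z' /y'; ring.
have := orthop_low sG.
rewrite (_ : P n * _ = P n * G - x%:P * (P n * P n.+2) - y'%:P * (P n * P n.+1) - z'%:P * (P n * P n));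
  last by ring.
rewrite !mom_funB !mom_funCM [P n * P n.+2]mulrC [P n * P n.+1]mulrC (@orthop_orth n n.+2) ?(@orthop_orth n n.+1) //.
by rewrite !mulr0 !subr0 => /eqP; rewrite subr_eq0 => /eqP.
Qed.

(** The coefficient matrix C of the P_i is unitriangular, and C M C^T is the Gram matrix diag(h_0,
    ..., h_(n-1)). *)
Lemma hankel_det n : \det (\matrix_(i < n, j < n) mu (i + j)) = \prod_(k < n) h k.
Proof.
set M := \matrix_(_, _) _.
pose C : 'M[F]_n := \matrix_(i, j) (P i)`_j.
have detC : \det C = 1.
  rewrite det_trig; first by rewrite big1 // => i _; rewrite mxE lead_orthop.
  by apply/is_trig_mxP => i j ij; rewrite mxE nth_default // size_orthop.
have sP (i : 'I_n) : (size (P i) <= n)%N by rewrite size_orthop.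
have CMC : C *m M *m C^T = diag_mx (\row_k h k).
  apply/matrixP => i j; transitivity (L (P j * P i)); last first.
    rewrite !mxE; case: (eqVneq i j) => [->|]; first by rewrite mulr1n.
    rewrite mulr0n -(inj_eq val_inj) neq_ltn => /orP[] lt; first exact: orthop_orth.
    by rewrite mulrC orthop_orth.
  rewrite (mom_fun_mul (sP j) (sP i)) mxE; apply: eq_bigr => k _.
  rewrite !mxE mulrC mulr_sumr; apply: eq_bigr => l _.
  by rewrite !mxE addnC.
have := congr1 determinant CMC.
rewrite !det_mulmx det_tr detC mul1r mulr1 det_diag => ->.
by apply: eq_bigr => i _; rewrite mxE.
Qed.

Definition lin (u v : F) : {poly F} := u%:P * 'X + v%:P.

Lemma tops_lin u v G d x y z : tops G d x y z ->
  tops (lin u v * G) d.+1 (u * x) (u * y + v * x) (u * z + v * y).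
Proof.
move=> tG; have := tops_comb u v (topsX tG) (tops_up tG).
rewrite (_ : _ + _ = lin u v * G); last by rewrite /lin; ring.
by congr tops; ring.
Qed.

Lemma tops_low G d : (size G <= d)%N -> exists y z, tops G d 0 y z.
Proof.
move=> sG; exists (('X^2 * G)`_d.+1), (('X^2 * G)`_d); split=> //; first exact: leqW.
by rewrite coefXnM /= !subSS subn0 nth_default.
Qed.

Lemma tops00_size G n z : tops G n.+2 0 0 z -> (size G <= n.+1)%N.
Proof. by move=> tG; apply: tops0_size; exact: tops_up tG. Qed.

(** * The Pearson equation and the Lax matrix *)

Variables al be ga t : F.
Let s := al + be + ga.

Definition pearson_mid := (al + 1) * (1 + t) + (be + 1) * t + (ga + 1).

(* [x (1-x) (x-t) G' = dquad * ('X * G')], and [pearson_quad] is the quadratic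
   polynomial tau of the Pearson equation (x (1-x) (x-t) w)' = tau w. *)
Definition dquad := quad (-1) (1 + t) (- t).
Definition pearson_quad := quad (- (3%:R + s)) pearson_mid (- ((al + 1) * t)).

(** For the weight this says that the integral of (x^(k+1) (1-x) (x-t) w)' vanishes. *)
Hypothesis pearson_mom : forall k,
  - (k%:R + 3%:R + s) * mu k.+2 + (k%:R * (1 + t) + pearson_mid) * mu k.+1
  - t * (k%:R + al + 1) * mu k = 0.

Lemma pearson_fun G : L (dquad * ('X * G^`()) + pearson_quad * G) = 0.
Proof.
elim/poly_ind_monomial: G => [|u k G IH].
  by rewrite deriv0 !mulr0 addr0 mom_fun0.
have -> : dquad * ('X * (u *: 'X^k + G)^`()) + pearson_quad * (u *: 'X^k + G) =
  u *: (dquad * ('X * ('X^k)^`()) + pearson_quad * 'X^k)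
  + (dquad * ('X * G^`()) + pearson_quad * G).
  by rewrite derivD derivZ -!mul_polyC; ring.
rewrite mom_funD IH addr0 mom_funZ theta_Xn.
have -> : dquad * (k%:R%:P * 'X^k) + pearson_quad * 'X^k =
  (- (k%:R + 3%:R + s)) *: 'X^(k.+2) + (k%:R * (1 + t) + pearson_mid) *: 'X^(k.+1)
  - (t * (k%:R + al + 1)) *: 'X^k :> {poly F}.
  by rewrite /dquad /pearson_quad /quad !exprS expr0 -!mul_polyC; ring.
by rewrite !(mom_funB, mom_funD, mom_funZ, mom_funXn) pearson_mom mulr0.
Qed.

(** Integration by parts: [pearson_fun] applied to the product G K. *)
Lemma pearson_pair G K :
  L (dquad * ('X * G^`()) * K) = - L (G * (dquad * ('X * K^`()) + pearson_quad * K)).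
Proof.
apply/eqP; rewrite -addr_eq0 -mom_funD -[X in _ == X](pearson_fun (G * K)).
by apply/eqP; congr L; rewrite derivM; ring.
Qed.

(* Along the deformation in t, [eta n] is t (1-t) h_n' / h_n and [pidot n] is
   t (1-t) times the derivative of [coef1 n]: see [sqnorm_der], [coef1_der]. *)
Definition eta n : F := 2%:R * n%:R + 1 + al + ga * (1 - t) + 2%:R * coef1 n
  - (2%:R * n%:R + 2%:R + s) * rec_a n.
Definition pidot n : F :=
  coef1 n + coef1 n ^+ 2 - 2%:R * coef2 n + (2%:R * n%:R + 1 + s) * rec_b n.

(* Entries of the Lax matrix, with n = m + 1 in the second row:
   x (1-x) (x-t) (P_n, P_m)' = lax (P_n, P_m). *)
Definition lax11 n := quad (- n%:R) (n%:R * (1 + t) + coef1 n)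
  (- (t * (n%:R + coef1 n)) - pidot n).
Definition lax12 n := lin (rec_b n * (2%:R * n%:R + 1 + s))
  (- (rec_b n * ((2%:R * n%:R + 1 + s) * t + eta n))).
Definition lax21 m := lin (- (2%:R * m%:R + 1 + s)) ((2%:R * m%:R + 1 + s) * t + eta m).
Definition lax22 n := quad (s + n%:R)
  (- (al * (1 + t) + be * t + ga) - (n%:R * (1 + t) + coef1 n))
  (al * t + t * (n%:R + coef1 n) + pidot n).

Lemma hS m : h m.+1 = rec_b m.+1 * h m.
Proof. by rewrite rec_bS divfK. Qed.

(** The entries are chosen so that the three top coefficients of both sides agree. The difference R
    then has degree at most m, and it is orthogonal to P_0, ..., P_m by integration by parts and
    [L_tops], hence zero. *)
Lemma lax_row1 m :
  dquad * ('X * (P m.+1)^`()) = lax11 m.+1 * P m.+1 + lax12 m.+1 * P m.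
Proof.
apply/eqP; rewrite -subr_eq0; apply/eqP; set R := _ - _.
have tR : tops R m.+3 0 0 0.
  have t1 := tops_quad (-1) (1 + t) (- t) (tops_theta (tops_orthop m.+1)).
  have t2 := tops_quad (- m.+1%:R) (m.+1%:R * (1 + t) + coef1 m.+1)
    (- (t * (m.+1%:R + coef1 m.+1)) - pidot m.+1) (tops_orthop m.+1).
  have t3 := tops_up (tops_up (tops_lin (rec_b m.+1 * (2%:R * m.+1%:R + 1 + s))
    (- (rec_b m.+1 * ((2%:R * m.+1%:R + 1 + s) * t + eta m.+1))) (tops_orthop m))).
  have := tops_comb 1 (-1) (tops_comb 1 (-1) t1 t2) t3.
  rewrite (_ : _ + _ = R); last by rewrite /R /dquad /lax11 /lax12; ring.
  by congr tops; rewrite /pidot /=; ring.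
apply: (orthop_nondeg (tops0_size tR)) => k; rewrite ltnS => km.
(* P_k is viewed as a polynomial of degree at most m + 1 with unknown lower coefficients, so one
   computation serves all k <= m. *)
have [g [z tG]] : exists g z, tops (P k) m.+1 0 g z.
  by apply: tops_low; rewrite size_orthop.
have -> : L (R * P k) =
  - L (P m.+1 * (dquad * ('X * (P k)^`()) + pearson_quad * P k + lax11 m.+1 * P k))
  - L (P m * (lax12 m.+1 * P k)).
  transitivity (L (dquad * ('X * (P m.+1)^`()) * P k)
    - L (P m.+1 * (lax11 m.+1 * P k)) - L (P m * (lax12 m.+1 * P k))).
    by rewrite -!mom_funB; congr L; rewrite /R; ring.
  by rewrite pearson_pair [P m.+1 * (_ + lax11 _ * _)]mulrDr mom_funD; ring.
have t1 := tops_comb 1 1 (tops_comb 1 1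
  (tops_quad (-1) (1 + t) (- t) (tops_theta tG))
  (tops_quad (- (3%:R + s)) pearson_mid (- ((al + 1) * t)) tG))
  (tops_quad (- m.+1%:R) (m.+1%:R * (1 + t) + coef1 m.+1)
    (- (t * (m.+1%:R + coef1 m.+1)) - pidot m.+1) tG).
have t2 := tops_lin (rec_b m.+1 * (2%:R * m.+1%:R + 1 + s))
    (- (rec_b m.+1 * ((2%:R * m.+1%:R + 1 + s) * t + eta m.+1))) tG.
rewrite [L (P m * _)](L_tops t2).
rewrite (_ : dquad * _ + _ + _ = 1%:P * (1%:P * (dquad * ('X * (P k)^`())) +
   1%:P * (pearson_quad * P k)) + 1%:P * (lax11 m.+1 * P k)); last by ring.
rewrite (L_tops t1) hS /eta /pearson_mid /s /=; ring.
Qed.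

(** As for the first row, but matching two top coefficients already brings the degree of R down to
    m. *)
Lemma lax_row2 m :
  dquad * ('X * (P m)^`()) = lax21 m * P m.+1 + lax22 m.+1 * P m.
Proof.
apply/eqP; rewrite -subr_eq0; apply/eqP; set R := _ - _.
have [c tR] : exists c, tops R m.+2 0 0 c.
  have t1 := tops_quad (-1) (1 + t) (- t) (tops_theta (tops_orthop m)).
  have t2 := tops_lin (- (2%:R * m%:R + 1 + s)) ((2%:R * m%:R + 1 + s) * t + eta m)
    (tops_orthop m.+1).
  have t3 := tops_quad (s + m.+1%:R)
    (- (al * (1 + t) + be * t + ga) - (m.+1%:R * (1 + t) + coef1 m.+1))
    (al * t + t * (m.+1%:R + coef1 m.+1) + pidot m.+1) (tops_orthop m).
  have := tops_comb 1 (-1) (tops_comb 1 (-1) t1 t2) t3.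
  rewrite (_ : _ + _ = R); last by rewrite /R /dquad /lax21 /lax22; ring.
  set c := (_ + _ in X in tops _ _ _ _ X) => tR; exists c.
  by move: tR; congr tops; rewrite /eta /s /=; ring.
apply: (orthop_nondeg (tops00_size tR)) => k; rewrite ltnS => km.
(* Here P_k is viewed at degree m; the top coefficient g is 1 for k = m and 0 below. *)
have [g [z [w tG]]] : exists g z w, tops (P k) m g z w.
  move: km; rewrite leq_eqVlt => /predU1P[->|km].
    by exists 1, (coef1 m), (coef2 m); exact: tops_orthop.
  have [|y [z tG]] := @tops_low (P k) m; first by rewrite size_orthop.
  by exists 0, y, z.
have -> : L (R * P k) =
  - L (P m * (dquad * ('X * (P k)^`()) + pearson_quad * P k + lax22 m.+1 * P k))
  - L (P m.+1 * (lax21 m * P k)).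
  transitivity (L (dquad * ('X * (P m)^`()) * P k)
    - L (P m * (lax22 m.+1 * P k)) - L (P m.+1 * (lax21 m * P k))).
    by rewrite -!mom_funB; congr L; rewrite /R; ring.
  by rewrite pearson_pair [P m * (_ + lax22 _ * _)]mulrDr mom_funD; ring.
have t1 := tops_comb 1 1 (tops_comb 1 1
  (tops_quad (-1) (1 + t) (- t) (tops_theta tG))
  (tops_quad (- (3%:R + s)) pearson_mid (- ((al + 1) * t)) tG))
  (tops_quad (s + m.+1%:R)
    (- (al * (1 + t) + be * t + ga) - (m.+1%:R * (1 + t) + coef1 m.+1))
    (al * t + t * (m.+1%:R + coef1 m.+1) + pidot m.+1) tG).
have t2 := tops_up (tops_up (tops_lin (- (2%:R * m%:R + 1 + s))
  ((2%:R * m%:R + 1 + s) * t + eta m) tG)).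
rewrite [L (P m.+1 * _)](L_tops t2).
rewrite (_ : dquad * _ + _ + _ = 1%:P * (1%:P * (dquad * ('X * (P k)^`())) +
   1%:P * (pearson_quad * P k)) + 1%:P * (lax22 m.+1 * P k)); last by ring.
rewrite (L_tops t1) hS /pidot /pearson_mid /s /=; ring.
Qed.

(** Since [rec_b] is nonzero at positive indices, a common root would descend along the recurrence
    to P_0 = 1. *)
Lemma orthop_no_common_root m c : ~ ((P m.+1).[c] = 0 /\ (P m).[c] = 0).
Proof.
elim: m => [|m IH] [P1 P0].
  by move/eqP: P0; rewrite orthop0 hornerE oner_eq0.
apply: IH; split=> //; move: P1.
rewrite orthopSS !hornerE P0 mulr0 sub0r => /eqP.
by rewrite oppr_eq0 mulf_eq0 rec_bS mulf_eq0 invr_eq0 !(negPf (h_neq0 _)) => /eqP.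
Qed.

(* The Lax matrix kills (P_n, P_(n-1)) at each zero c of x (1-x) (x-t). *)
Lemma lax_det m c : dquad.[c] * c = 0 ->
  (lax11 m.+1).[c] * (lax22 m.+1).[c] = (lax12 m.+1).[c] * (lax21 m).[c].
Proof.
move=> c0.
have row G : (dquad * ('X * G^`())).[c] = 0.
  by rewrite hornerM hornerM hornerX mulrA c0 mul0r.
have comb (A B G K : {poly F}) : (A * G + B * K).[c] = A.[c] * G.[c] + B.[c] * K.[c].
  by rewrite hornerD !hornerM.
have := row (P m.+1); have := row (P m); rewrite lax_row1 lax_row2 !comb.
set u := (P m.+1).[c]; set v := (P m).[c].
set A := (lax11 _).[c]; set B := (lax12 _).[c]; set C := (lax21 _).[c]; set D := (lax22 _).[c].
move=> r2 r1; apply/eqP; rewrite -subr_eq0; apply/negPn/negP => d0.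
have du : (A * D - B * C) * u = 0.
  rewrite (_ : _ * u = D * (A * u + B * v) - B * (C * u + D * v)); last by ring.
  by rewrite r1 r2 !mulr0 subrr.
have dv : (A * D - B * C) * v = 0.
  rewrite (_ : _ * v = A * (C * u + D * v) - C * (A * u + B * v)); last by ring.
  by rewrite r1 r2 !mulr0 subrr.
move/eqP: du; move/eqP: dv; rewrite !mulf_eq0 (negPf d0) => /eqP v0 /eqP u0.
exact: (@orthop_no_common_root m c).
Qed.

Lemma horner_quad u v w c : (quad u v w).[c] = u * c ^+ 2 + v * c + w.
Proof. by rewrite /quad !hornerE. Qed.
Lemma horner_lin u v c : (lin u v).[c] = u * c + v.
Proof. by rewrite /lin !hornerE. Qed.

(** At x = t the diagonal entries reduce to - pidot and pidot - ga t (1-t), the others to - b eta_n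
    and eta_m. *)
Lemma lax_det_t m : pidot m.+1 * (pidot m.+1 - ga * (t * (1 - t)))
  = rec_b m.+1 * eta m.+1 * eta m.
Proof.
have c0 : dquad.[t] * t = 0 by rewrite horner_quad; ring.
have := lax_det m c0; rewrite !horner_quad !horner_lin => H.
transitivity (- ((- m.+1%:R * t ^+ 2 + (m.+1%:R * (1 + t) + coef1 m.+1) * t +
   (- (t * (m.+1%:R + coef1 m.+1)) - pidot m.+1)) * ((s + m.+1%:R) * t ^+ 2 +
  (- (al * (1 + t) + be * t + ga) - (m.+1%:R * (1 + t) + coef1 m.+1)) * t +
  (al * t + t * (m.+1%:R + coef1 m.+1) + pidot m.+1)))).
  by rewrite /s; ring.
by rewrite H; ring.
Qed.

Lemma lax_det_0 m (n := m.+1) (p := coef1 n) :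
  (t * (n%:R + p) + pidot n) * (t * (n%:R + p) + pidot n + al * t)
  = rec_b n * ((2%:R * n%:R + 1 + s) * t + eta n) * ((2%:R * m%:R + 1 + s) * t + eta m).
Proof.
have := lax_det m (mulr0 dquad.[0]); rewrite !horner_quad !horner_lin => H.
transitivity (- ((- n%:R * 0 ^+ 2 + (n%:R * (1 + t) + p) * 0 +
   (- (t * (n%:R + p)) - pidot n)) * ((s + n%:R) * 0 ^+ 2 +
  (- (al * (1 + t) + be * t + ga) - (n%:R * (1 + t) + p)) * 0 +
  (al * t + t * (n%:R + p) + pidot n)))).
  by ring.
by rewrite H /p /n; ring.
Qed.

Lemma lax_det_1 m (n := m.+1) (p := coef1 n) :
  ((1 - t) * p - pidot n) * ((1 - t) * p - pidot n - be * (1 - t))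
  = rec_b n * ((2%:R * n%:R + 1 + s) * (1 - t) - eta n)
    * ((2%:R * m%:R + 1 + s) * (1 - t) - eta m).
Proof.
have c0 : dquad.[1] * 1 = 0 by rewrite horner_quad; ring.
have := lax_det m c0; rewrite !horner_quad !horner_lin => H.
transitivity (- ((- n%:R * 1 ^+ 2 + (n%:R * (1 + t) + p) * 1 +
   (- (t * (n%:R + p)) - pidot n)) * ((s + n%:R) * 1 ^+ 2 +
  (- (al * (1 + t) + be * t + ga) - (n%:R * (1 + t) + p)) * 1 +
  (al * t + t * (n%:R + p) + pidot n)))).
  by rewrite /s; ring.
by rewrite H /p /n; ring.
Qed.

(** * Eliminating between the three determinant relations *)

Section Invariants.
Variable m : nat.
Hypotheses (t_neq0 : t != 0) (t1_neq0 : 1 - t != 0).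
Let n := m.+1.
Let N := 2%:R * n%:R + s.
Let p := coef1 n.
Let X0 := t * (n%:R + p) * (n%:R + p + al) + pidot n * (2%:R * (n%:R + p) + al)
  + ga * (1 - t) * pidot n.
Let X1 := (1 - t) * p * (p - be) - pidot n * (2%:R * p - be) + ga * t * pidot n.
Let Y := rec_b n * ((N + 1) * eta m + (N - 1) * eta n).

(** Subtracting the relation at t from the one at 0 cancels pidot^2 and b eta_n eta_m; what is left
    is divisible by t. The relation at 1 is treated alike, with 1 - t. *)
Let X0E : X0 = (N ^+ 2 - 1) * rec_b n * t + Y.
Proof.
apply: (mulfI t_neq0); apply/eqP; rewrite -subr_eq0; apply/eqP.
have e0 := lax_det_0 m; have et := lax_det_t m.
transitivity ((t * (n%:R + p) + pidot n) * (t * (n%:R + p) + pidot n + al * t)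
  - rec_b n * ((2%:R * n%:R + 1 + s) * t + eta n) * ((2%:R * m%:R + 1 + s) * t + eta m)
  - (pidot n * (pidot n - ga * (t * (1 - t))) - rec_b n * eta n * eta m)).
  by rewrite /X0 /Y /N /p /n; ring.
by rewrite /p /n e0 et; ring.
Qed.

Let X1E : X1 = (N ^+ 2 - 1) * rec_b n * (1 - t) - Y.
Proof.
apply: (mulfI t1_neq0); apply/eqP; rewrite -subr_eq0; apply/eqP.
have e1 := lax_det_1 m; have et := lax_det_t m.
transitivity (((1 - t) * p - pidot n) * ((1 - t) * p - pidot n - be * (1 - t))
  - rec_b n * ((2%:R * n%:R + 1 + s) * (1 - t) - eta n)
    * ((2%:R * m%:R + 1 + s) * (1 - t) - eta m)
  - (pidot n * (pidot n - ga * (t * (1 - t))) - rec_b n * eta n * eta m)).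
  by rewrite /X1 /Y /N /p /n; ring.
by rewrite /p /n e1 et; ring.
Qed.

(** [Y] cancels in X0 + X1, which leaves b alone. *)
Lemma rec_b_coef1 : (N ^+ 2 - 1) * rec_b n =
  p ^+ 2 + (2%:R * n%:R * t + al * t - be * (1 - t)) * p + N * pidot n
  + n%:R ^+ 2 * t + al * n%:R * t.
Proof.
transitivity (X0 + X1); last by rewrite /X0 /X1 /N /s; ring.
by rewrite X0E X1E; ring.
Qed.

(** b cancels in (1-t) X0 - t X1, which leaves [Y]. *)
Lemma rec_b_eta : Y =
  2%:R * p * pidot n + (ga * (1 - 2%:R * t) + 2%:R * n%:R * (1 - t) + al * (1 - t) - be * t)
    * pidot n
  + t * (1 - t) * ((2%:R * n%:R + al + be) * p + n%:R ^+ 2 + al * n%:R).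
Proof.
transitivity ((1 - t) * X0 - t * X1); last by rewrite /X0 /X1; ring.
by rewrite X0E X1E; ring.
Qed.
End Invariants.

(** As a_k = p_k - p_(k+1), the sum telescopes. Along the deformation it is t (1-t) (ln D_n)'. *)
Lemma eta_sum n : \sum_(k < n) eta k =
  n%:R ^+ 2 + n%:R * (al + ga * (1 - t)) + (2%:R * n%:R + s) * coef1 n.
Proof.
elim: n => [|n IH]; first by rewrite big_ord0 /=; ring.
by rewrite big_ord_recr /= IH /eta; ring.
Qed.

(** The multiplication part of the operator x (1-x) d/dx + [drift], through which t (1-t) d/dt acts
    on the moment functional; see [drift_fun]. *)
Definition drift := lin (- (2%:R + s)) (1 + al + ga * (1 - t)).

Lemma drift_norm n :
  L (lin (-1) 1 * ('X * (P n * P n)^`()) + drift * (P n * P n)) = eta n * h n.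
Proof.
have t1 := tops_up (tops_lin (-1) 1 (tops_theta (tops_orthop n))).
have t2 := tops_up (tops_lin (- (2%:R + s)) (1 + al + ga * (1 - t)) (tops_orthop n)).
transitivity (2%:R * L (P n * (lin (-1) 1 * ('X * (P n)^`()))) + L (P n * (drift * P n))).
  by rewrite -mom_funZ -mom_funD; congr L; rewrite derivM -mul_polyC; ring.
by rewrite (L_tops t1) (L_tops t2) /eta /s /=; ring.
Qed.

(** Differentiating the orthogonality of P_(m+1) and P_m in t produces this pairing; it identifies
    [pidot] in [coef1_der]. *)
Lemma drift_mixed m :
  L (lin (-1) 1 * ('X * (P m.+1 * P m)^`()) + drift * (P m.+1 * P m)) = - pidot m.+1 * h m.
Proof.
have t1 := tops_lin (-1) 1 (tops_theta (tops_orthop m.+1)).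
have t2 := tops_up (tops_up (tops_lin (-1) 1 (tops_theta (tops_orthop m)))).
have t3 := tops_up (tops_up (tops_lin (- (2%:R + s)) (1 + al + ga * (1 - t)) (tops_orthop m))).
transitivity (L (P m * (lin (-1) 1 * ('X * (P m.+1)^`())))
  + L (P m.+1 * (lin (-1) 1 * ('X * (P m)^`()))) + L (P m.+1 * (drift * P m))).
  by rewrite -!mom_funD; congr L; rewrite derivM; ring.
by rewrite (L_tops t1) (L_tops t2) (L_tops t3) hS /pidot /s /=; ring.
Qed.

End Functional.

(** Both sides are linear in G. On x^k the claim is the hypothesis, because x (1-x) (x^k)' = k x^k -
    k x^(k+1). *)
Lemma drift_fun (F : fieldType) (mu dmu : nat -> F) (al be ga t : F) G :
  (forall k, t * (1 - t) * dmu k = (k%:R + 1 + al + ga * (1 - t)) * mu k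
     - (k%:R + 2%:R + (al + be + ga)) * mu k.+1) ->
  t * (1 - t) * mom_fun dmu G =
  mom_fun mu (lin (-1) 1 * ('X * G^`()) + drift al be ga t * G).
Proof.
move=> dmuE; elim/poly_ind_monomial: G => [|u k G IH].
  by rewrite deriv0 !mulr0 addr0 /mom_fun size_poly0 !big_ord0 mulr0.
have -> : lin (-1) 1 * ('X * (u *: 'X^k + G)^`()) + drift al be ga t * (u *: 'X^k + G) =
  u *: (lin (-1) 1 * ('X * ('X^k)^`()) + drift al be ga t * 'X^k)
  + (lin (-1) 1 * ('X * G^`()) + drift al be ga t * G).
  by rewrite derivD derivZ -!mul_polyC; ring.
rewrite [RHS]mom_funD -IH [X in _ = X + _]mom_funZ theta_Xn.
have -> : lin (-1) 1 * (k%:R%:P * 'X^k) + drift al be ga t * 'X^k =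
  (k%:R + 1 + al + ga * (1 - t)) *: 'X^k - (k%:R + 2%:R + (al + be + ga)) *: 'X^(k.+1) :> {poly F}.
  by rewrite /drift /lin exprS -!mul_polyC; ring.
rewrite mom_funB !mom_funZ !mom_funXn -dmuE.
have -> : mom_fun dmu (u *: 'X^k + G) = u * dmu k + mom_fun dmu G.
  by rewrite mom_funD mom_funZ mom_funXn.
ring.
Qed.

(** The two linear relations give 2 (N-1) a = T (K + x) and 2 (N+1) b = T (K - x); their product is
    compared with the given value of a b. In the application a = b_n eta_n, b = b_n eta_(n-1), x = t
    (1-t) p_n'' and y = p_n'. *)
Lemma sigma_elimination (F : fieldType) (N T K x a b c G y ga : F) :
  N != 0 -> T != 0 ->
  (N ^+ 2 - 1) * (a - b) = T * (K + N * x) -> (N + 1) * b + (N - 1) * a = T * K ->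
  a * b = c * (T ^+ 2 * (y * (y - ga))) -> (N ^+ 2 - 1) * c = G ->
  x ^+ 2 = K ^+ 2 - 4%:R * y * (y - ga) * G.
Proof.
move=> N0 T0 eD eS eP eG.
have ea : 2%:R * (N - 1) * a = T * (K + x).
  apply: (mulfI N0).
  transitivity ((N ^+ 2 - 1) * (a - b) + (N - 1) * ((N + 1) * b + (N - 1) * a)); first by ring.
  by rewrite eD eS; ring.
have eb : 2%:R * (N + 1) * b = T * (K - x).
  apply: (mulfI N0).
  transitivity ((N + 1) * ((N + 1) * b + (N - 1) * a) - (N ^+ 2 - 1) * (a - b)); first by ring.
  by rewrite eD eS; ring.
have T2 : T ^+ 2 != 0 by rewrite expf_neq0.
apply: (mulfI T2); apply/eqP; rewrite -subr_eq0; apply/eqP.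
transitivity (4%:R * T ^+ 2 * (y * (y - ga)) * G - (T * (K + x)) * (T * (K - x))); first by ring.
rewrite -ea -eb -eG.
transitivity (4%:R * (N ^+ 2 - 1) * (c * (T ^+ 2 * (y * (y - ga))) - a * b)); first by ring.
by rewrite eP subrr mulr0.
Qed.

End OrthoPoly.

(** * Derivatives on the open interval (0,1) *)

Module Locality.
Import Coquelicot.
Definition in01 (t : R) := 0 < t < 1.

Lemma in01_neq0 (t : R) : in01 t -> t * (1 - t) <> 0.
Proof. unfold in01; nra. Qed.

(** The identities between functions of t hold on (0,1) only, so derivatives are transported by
    local equality. *)
Lemma derivable_pt_lim_local (f g : R -> R) (a b t l : R) : a < t < b ->
  (forall s, a < s < b -> f s = g s) -> derivable_pt_lim f t l -> derivable_pt_lim g t l.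
Proof.
intros atb fg Df; apply is_derive_Reals; apply is_derive_Reals in Df.
apply (is_derive_ext_loc f); [| exact Df].
assert (d0 : 0 < Rmin (t - a) (b - t)) by (apply Rmin_pos; lra).
exists (mkposreal _ d0); intros s Hs; apply fg.
unfold ball in Hs; simpl in Hs; unfold AbsRing_ball, abs, minus, plus, opp in Hs; simpl in Hs.
apply Rabs_lt_between in Hs.
pose proof (Rmin_l (t - a) (b - t)); pose proof (Rmin_r (t - a) (b - t)); lra.
Qed.

Lemma derivable_pt_lim_Derive (f : R -> R) (t : R) :
  (exists l, derivable_pt_lim f t l) -> derivable_pt_lim f t (Derive f t).
Proof.
intros [l Dl]; apply is_derive_Reals, Derive_correct; exists l; now apply is_derive_Reals.
Qed.
End Locality.

(** * Deformation in t *)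

Module Deform.
Import all_boot all_order all_algebra ring Rstruct.
Import GRing.Theory OrthoPoly Locality.
Local Open Scope ring_scope.
Set Implicit Arguments.
Unset Strict Implicit.
Unset Printing Implicit Defensive.

Local Notation is_der := derivable_pt_lim.

Lemma is_der_cst (c t : R) : is_der (fun _ => c) t 0.
Proof. exact: derivable_pt_lim_const. Qed.
Lemma is_derD f g (t l k : R) : is_der f t l -> is_der g t k ->
  is_der (fun s => f s + g s) t (l + k).
Proof. exact: derivable_pt_lim_plus. Qed.
Lemma is_derB f g (t l k : R) : is_der f t l -> is_der g t k ->
  is_der (fun s => f s - g s) t (l - k).
Proof. exact: derivable_pt_lim_minus. Qed.
Lemma is_derM f g (t l k : R) : is_der f t l -> is_der g t k ->
  is_der (fun s => f s * g s) t (l * g t + f t * k).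
Proof. exact: derivable_pt_lim_mult. Qed.
Lemma is_der_div f g (t l k : R) : is_der f t l -> is_der g t k -> g t != 0 ->
  is_der (fun s => f s / g s) t ((l * g t - k * f t) / (g t * g t)).
Proof. by move=> Df Dg /eqP g0; exact: (derivable_pt_lim_div f g t l k Df Dg g0). Qed.

Lemma is_der_eq (f g : R -> R) t l : (forall s, f s = g s) -> is_der f t l -> is_der g t l.
Proof.
by move=> fg Df e e0; have [d Dd] := Df e e0; exists d => x x0 xd; rewrite -!fg; apply: Dd.
Qed.

Lemma is_der_sum n (f : nat -> R -> R) (l : nat -> R) t :
  (forall i, is_der (f i) t (l i)) ->
  is_der (fun s => \sum_(i < n) f i s) t (\sum_(i < n) l i).
Proof.
move=> D; elim: n => [|n IH].
  rewrite big_ord0; apply: is_der_eq (is_der_cst 0 t) => s; by rewrite big_ord0.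
rewrite big_ord_recr; apply: is_der_eq (is_derD IH (D n)) => s; by rewrite big_ord_recr.
Qed.

Definition smooth_at (f : R -> R) t := exists l, is_der f t l.
Definition smoothp_at (G : R -> {poly R}) t := forall i, smooth_at (fun s => (G s)`_i) t.
Definition pder (G : R -> {poly R}) t (dG : {poly R}) :=
  forall i, is_der (fun s => (G s)`_i) t dG`_i.

Lemma smoothp_pder (G : R -> {poly R}) t n : (forall s, (size (G s) <= n)%N) -> smoothp_at G t ->
  exists2 dG : {poly R}, (size dG <= n)%N & pder G t dG.
Proof.
move=> sG Gt; exists (\poly_(i < n) Coquelicot.Derive.Derive (fun s => (G s)`_i) t).
  exact: size_poly.
move=> i; rewrite coef_poly; case: ltnP => ni.
  by apply: derivable_pt_lim_Derive; exact: Gt.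
apply: is_der_eq (is_der_cst 0 t) => s.
by rewrite nth_default // (leq_trans (sG s)).
Qed.

(** * Derivatives in t of norms, subleading coefficients and recurrence coefficients *)

Section Moments.
Variable mu : R -> nat -> R.

(** With sizes bounded uniformly in s, the product rule applies to each term of a fixed double sum
    and yields three contributions: from G, from K and from the moments. *)
Lemma mom_fun_der n (G K : R -> {poly R}) t (dG dK : {poly R}) (dmu : nat -> R) :
  (forall s, (size (G s) <= n)%N) -> (forall s, (size (K s) <= n)%N) ->
  (size dG <= n)%N -> (size dK <= n)%N ->
  pder G t dG -> pder K t dK -> (forall k, is_der (mu^~ k) t (dmu k)) ->
  is_der (fun s => mom_fun (mu s) (G s * K s)) t
    (mom_fun (mu t) (dG * K t) + mom_fun (mu t) (G t * dK) + mom_fun dmu (G t * K t)).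
Proof.
move=> sG sK sdG sdK DG DK Dmu.
rewrite (mom_fun_mul _ sdG (sK t)) (mom_fun_mul _ (sG t) sdK) (mom_fun_mul _ (sG t) (sK t)).
have E s : \sum_(i < n) \sum_(j < n) (G s)`_i * ((K s)`_j * mu s (i + j))
   = mom_fun (mu s) (G s * K s) by rewrite (mom_fun_mul _ (sG s) (sK s)).
apply: (is_der_eq E); rewrite -!big_split /=.
pose l (i j : nat) := dG`_i * ((K t)`_j * mu t (i + j)) +
  (G t)`_i * (dK`_j * mu t (i + j) + (K t)`_j * dmu (i + j)%N).
have -> : \sum_(i < n) (\sum_(j < n) dG`_i * ((K t)`_j * mu t (i + j))
    + \sum_(j < n) (G t)`_i * (dK`_j * mu t (i + j))
    + \sum_(j < n) (G t)`_i * ((K t)`_j * dmu (i + j)%N)) =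
    \sum_(i < n) \sum_(j < n) l i j.
  apply: eq_bigr => i _; rewrite -!big_split /=; apply: eq_bigr => j _.
  by rewrite /l; ring.
apply: (@is_der_sum n (fun i s => \sum_(j < n) (G s)`_i * ((K s)`_j * mu s (i + j)))
  (fun i => \sum_(j < n) l i j)) => i.
apply: (@is_der_sum n (fun j s => (G s)`_i * ((K s)`_j * mu s (i + j))) (l i)) => j.
exact: (is_derM (DG i) (is_derM (DK j) (Dmu (i + j)%N))).
Qed.

Lemma mom_fun_smooth n (G K : R -> {poly R}) t :
  (forall s, (size (G s) <= n)%N) -> (forall s, (size (K s) <= n)%N) ->
  smoothp_at G t -> smoothp_at K t -> (forall k, smooth_at (mu^~ k) t) ->
  smooth_at (fun s => mom_fun (mu s) (G s * K s)) t.
Proof.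
move=> sG sK /(smoothp_pder sG)[dG sdG DG] /(smoothp_pder sK)[dK sdK DK] Dmu.
eexists; apply: (mom_fun_der sG sK sdG sdK DG DK) => k.
by apply: derivable_pt_lim_Derive; exact: Dmu.
Qed.

Variables al be ga : R.
Hypothesis pearson_mom : forall t, in01 t -> forall k,
  - (k%:R + 3%:R + (al + be + ga)) * mu t k.+2
  + (k%:R * (1 + t) + pearson_mid al be ga t) * mu t k.+1
  - t * (k%:R + al + 1) * mu t k = 0.
Variable dmu : R -> nat -> R.
Hypothesis mu_der : forall t, in01 t -> forall k, is_der (mu^~ k) t (dmu t k).
Hypothesis dmuE : forall t, in01 t -> forall k,
  t * (1 - t) * dmu t k = (k%:R + 1 + al + ga * (1 - t)) * mu t k
     - (k%:R + 2%:R + (al + be + ga)) * mu t k.+1.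
Hypothesis h_neq0 : forall t, in01 t -> forall n, sqnorm (mu t) n != 0.

Lemma size_ortho_pair2 s n : (size (ortho_pair (mu s) n).2 <= n.+1)%N.
Proof.
case: n => [|n]; first by rewrite size_poly0.
by rewrite ortho_pairS size_orthop.
Qed.

(** Induction along the recurrence, whose coefficients are quotients of pairings with nonvanishing
    denominators. *)
Lemma ortho_pair_smooth t n : in01 t ->
  smoothp_at (fun s => orthop (mu s) n) t /\ smoothp_at (fun s => (ortho_pair (mu s) n).2) t.
Proof.
move=> t01; have mut k : smooth_at (mu^~ k) t by exists (dmu t k); exact: mu_der.
elim: n => [|n [IHP IHQ]].
  split=> i; exists 0; first exact: (is_der_cst (1 : {poly R})`_i).
  exact: (is_der_cst (0 : {poly R})`_i).
split; last first.
  by move=> i; have [l Dl] := IHP i; exists l; apply: is_der_eq Dl => s; rewrite ortho_pairS.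
have sP s : (size (orthop (mu s) n) <= n.+2)%N by rewrite size_orthop.
have sXP s : (size ('X * orthop (mu s) n)%R <= n.+2)%N.
  by rewrite (leq_trans (size_polyMleq _ _)) // size_polyX size_orthop.
have DXP : smoothp_at (fun s => 'X * orthop (mu s) n) t.
  move=> [|i]; first by exists 0; apply: is_der_eq (is_der_cst 0 t) => s; rewrite coefXM.
  by have [l Dl] := IHP i; exists l; apply: is_der_eq Dl => s; rewrite coefXM.
have [lh Dh] : smooth_at (fun s => sqnorm (mu s) n) t by exact: (mom_fun_smooth sP sP).
have [la Da] : smooth_at (fun s => rec_a (mu s) n) t.
  have [l Dl] := mom_fun_smooth sXP sP DXP IHP mut.
  eexists; apply: (is_der_eq _ (is_der_div Dl Dh (h_neq0 t01 n))) => s.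
  by rewrite /rec_a mulrA.
have [lb Db] : smooth_at (fun s => rec_b (mu s) n) t.
  (* For n = 0 the denominator in [rec_b] vanishes, so the quotient rule does not apply; the
     coefficient is constantly 0. *)
  case: n {sXP DXP Da la} IHP IHQ sP Dh => [|n] IHP IHQ sP Dh.
    by exists 0; apply: is_der_eq (is_der_cst 0 t) => s; rewrite rec_b0.
  have [l Dl] : smooth_at (fun s => sqnorm (mu s) n) t.
    have sQ s : (size (ortho_pair (mu s) n.+1).2 <= n.+2)%N by exact: size_ortho_pair2.
    have [l Dl] := mom_fun_smooth sQ sQ IHQ IHQ mut; exists l.
    by apply: is_der_eq Dl => s; rewrite ortho_pairS.
  eexists; apply: (is_der_eq _ (is_der_div Dh Dl (h_neq0 t01 n))) => s.
  by rewrite rec_bS.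
move=> i; have [lx Dx] := DXP i; have [lp Dp] := IHP i; have [lq Dq] := IHQ i.
eexists; apply: (is_der_eq _ (is_derB (is_derB Dx (is_derM Da Dp)) (is_derM Db Dq))) => s.
by rewrite orthopS coefB mulrBl coefB !coefCM.
Qed.

(** P_n is monic for every t, so its t-derivative has degree below n and is orthogonal to P_n. *)
Lemma orthop_pder t n : in01 t ->
  exists2 dP : {poly R}, (size dP <= n)%N & pder (fun s => orthop (mu s) n) t dP.
Proof.
move=> t01; have [Pt _] := ortho_pair_smooth n t01.
have sP s : (size (orthop (mu s) n) <= n.+1)%N by rewrite size_orthop.
have [dP sdP DP] := smoothp_pder sP Pt; exists dP => //.
apply/leq_sizeP => j; rewrite leq_eqVlt => /predU1P[<-|nj]; last first.
  by apply/eqP; rewrite nth_default // (leq_trans sdP).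
have D0 : is_der (fun s => (orthop (mu s) n)`_n) t 0.
  by apply: is_der_eq (is_der_cst 1 t) => s; rewrite lead_orthop.
exact: uniqueness_limite (DP n) D0.
Qed.

Let T_neq0 t : in01 t -> t * (1 - t) != 0.
Proof.
by move=> t01; apply/eqP; exact: in01_neq0.
Qed.

(** The derivatives of the two factors P_n drop out by orthogonality; the derivative of the moments
    is evaluated by [drift_fun] and [drift_norm]. *)
Lemma sqnorm_der t n : in01 t ->
  is_der (fun s => sqnorm (mu s) n) t
    (eta (mu t) al be ga t n * sqnorm (mu t) n / (t * (1 - t))).
Proof.
move=> t01; have [dP sdP DP] := orthop_pder n t01.
have sP s : (size (orthop (mu s) n) <= n.+1)%N by rewrite size_orthop.
have := mom_fun_der sP sP (leqW sdP) (leqW sdP) DP DP (mu_der t01).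
rewrite [dP * _]mulrC (orthop_low (h_neq0 t01) sdP) !add0r.
congr is_der; apply: (mulfI (T_neq0 t01)).
rewrite (drift_fun (orthop (mu t) n * orthop (mu t) n) (dmuE t01)) (drift_norm (h_neq0 t01)).
by rewrite [RHS]mulrC divfK // T_neq0.
Qed.

(** Differentiate L (P_(m+1) P_m) = 0. The derivative of P_(m+1) contributes p_(m+1)' h_m, that of
    P_m contributes nothing, and that of the moments is given by [drift_mixed]. *)
Lemma coef1_der t m : in01 t ->
  is_der (fun s => coef1 (mu s) m.+1) t (pidot (mu t) al be ga m.+1 / (t * (1 - t))).
Proof.
move=> t01; have [dP sdP DP] := orthop_pder m.+1 t01; have [dQ sdQ DQ] := orthop_pder m t01.
have sP s : (size (orthop (mu s) m.+1) <= m.+2)%N by rewrite size_orthop.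
have sQ s : (size (orthop (mu s) m) <= m.+2)%N by rewrite size_orthop leqW.
have D := mom_fun_der sP sQ (leqW sdP) (leqW (leqW sdQ)) DP DQ (mu_der t01).
have D0 : is_der (fun s => mom_fun (mu s) (orthop (mu s) m.+1 * orthop (mu s) m)) t 0.
  apply: (derivable_pt_lim_local (fun _ => 0) _ 0 1 t 0 t01 _ (is_der_cst 0 t)) => s s01.
  by rewrite (orthop_orth (h_neq0 s01)).
have := uniqueness_limite _ _ _ _ D D0.
rewrite (orthop_low (h_neq0 t01) (leqW sdQ)) addr0 [dP * _]mulrC.
have -> : mom_fun (mu t) (orthop (mu t) m * dP) = dP`_m * sqnorm (mu t) m.
  rewrite -[dP in LHS](subrK (dP`_m *: orthop (mu t) m)) mulrDr mom_funD.
  rewrite (orthop_low (h_neq0 t01)) ?orthop_reduce // add0r -scalerAr mom_funZ //.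
move=> E; have : is_der (fun s => (orthop (mu s) m.+1)`_m) t dP`_m by exact: DP.
move=> Dp; have : is_der (fun s => coef1 (mu s) m.+1) t dP`_m.
  by apply: is_der_eq Dp => s; rewrite sublead_orthop.
congr is_der; apply: (mulfI (T_neq0 t01)); rewrite [RHS]mulrC divfK ?T_neq0 //.
apply: (mulIf (h_neq0 t01 m)).
have := drift_fun (orthop (mu t) m.+1 * orthop (mu t) m) (dmuE t01).
rewrite (drift_mixed (h_neq0 t01)) => E2.
move/eqP: E; rewrite addr_eq0 => /eqP E.
by rewrite -mulrA E mulrN E2 mulNr opprK.
Qed.

(** With derivatives in logarithmic form, the product rule becomes a sum of the factors l. *)
Lemma is_der_prod n (f l : nat -> R -> R) t :
  (forall k, is_der (f k) t (l k t * f k t)) ->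
  is_der (fun s => \prod_(k < n) f k s) t ((\sum_(k < n) l k t) * \prod_(k < n) f k t).
Proof.
move=> D; elim: n => [|n IH].
  by rewrite !big_ord0 mul0r; apply: is_der_eq (is_der_cst 1 t) => s; rewrite big_ord0.
rewrite !big_ord_recr /=.
have E s : \prod_(k < n) f k s * f n s = \prod_(k < n.+1) f k s by rewrite big_ord_recr.
apply: (is_der_eq E).
have -> : (\sum_(k < n) l k t + l n t) * (\prod_(k < n) f k t * f n t) =
  (\sum_(k < n) l k t) * (\prod_(k < n) f k t) * f n t
  + \prod_(k < n) f k t * (l n t * f n t) by ring.
exact: is_derM.
Qed.

Lemma prod_sqnorm_der t n : in01 t ->
  is_der (fun s => \prod_(k < n) sqnorm (mu s) k) t
    ((n%:R ^+ 2 + n%:R * (al + ga * (1 - t))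
      + (2%:R * n%:R + (al + be + ga)) * coef1 (mu t) n) / (t * (1 - t))
     * \prod_(k < n) sqnorm (mu t) k).
Proof.
move=> t01; rewrite -eta_sum mulr_suml.
apply: (@is_der_prod n (fun k s => sqnorm (mu s) k)
  (fun k s => eta (mu s) al be ga s k / (s * (1 - s)))) => k.
by rewrite mulrAC; exact: sqnorm_der.
Qed.

Lemma is_der_val f (t l l' : R) : is_der f t l -> l = l' -> is_der f t l'.
Proof. by move=> D <-. Qed.

Lemma is_der_id (t : R) : is_der (fun s => s) t 1.
Proof. exact: derivable_pt_lim_id. Qed.

Lemma rec_b_der t m : in01 t ->
  is_der (fun s => rec_b (mu s) m.+1) t
    (rec_b (mu t) m.+1 * (eta (mu t) al be ga t m.+1 - eta (mu t) al be ga t m)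
     / (t * (1 - t))).
Proof.
move=> t01; have h0 := h_neq0 t01 m; have T0 := T_neq0 t01.
have E s : sqnorm (mu s) m.+1 / sqnorm (mu s) m = rec_b (mu s) m.+1 by rewrite rec_bS.
apply: (is_der_val (is_der_eq E (is_der_div (sqnorm_der m.+1 t01) (sqnorm_der m t01) h0))).
by rewrite rec_bS; move: T0; set T := t * (1 - t) => T0; field; rewrite h0 T0.
Qed.

(** * The second order equation for p_n *)

Section Sigma.
Variable m : nat.
Let n := m.+1.
Let N := 2%:R * n%:R + (al + be + ga).
Hypothesis N_neq0 : N != 0.
Let p t := coef1 (mu t) n.
Let pid t := pidot (mu t) al be ga n.
Let c2 := N ^+ 2 - 1.
Let c1 := 2%:R * n%:R + al + be.
Let c0 := n%:R ^+ 2 + al * n%:R.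
Let b t := rec_b (mu t) n.
Let T (t : R) := t * (1 - t).
Let db t := b t * (eta (mu t) al be ga t n - eta (mu t) al be ga t m) / T t.
Let p1 t := pid t / T t.
(** [pid1] is the derivative of the expression in [pidotE], and [p2] comes from the quotient rule
    for [pid] over t (1-t). *)
Let pid1 t := (c2 * db t - 2%:R * p1 t * p t - c1 * p t - (c1 * t - be) * p1 t - c0) / N.
Let p2 t := (pid1 t - (1 - 2%:R * t) * p1 t) / T t.

Let t_neq0s t : in01 t -> t != 0 /\ 1 - t != 0.
Proof. by move=> /T_neq0; rewrite mulf_eq0 negb_or => /andP. Qed.

(** [rec_b_coef1] solved for [pidot]: it can now be differentiated through p and b, without a
    derivative of [coef2]. *)
Let pidotE t : in01 t ->
  (c2 * b t - p t * p t - (c1 * t - be) * p t - c0 * t) * N^-1 = pid t.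
Proof.
move=> t01; have [t0 t1] := t_neq0s t01.
have := rec_b_coef1 (h_neq0 t01) (pearson_mom t01) m t0 t1.
rewrite -/n -/N -/c2 -/(b t) -/(p t) -/(pid t) => ->.
by rewrite -[RHS](mulfK N_neq0); congr (_ / _); rewrite /c1 /c0 /N /n; ring.
Qed.

Lemma coef1_der1 t : in01 t -> is_der p t (p1 t).
Proof. exact: coef1_der. Qed.

Let pidot_der t : in01 t -> is_der pid t (pid1 t).
Proof.
move=> t01; have Dp := coef1_der1 t01.
have Did := is_derB (is_derM (is_der_cst c1 t) (is_der_id t)) (is_der_cst be t).
have D := is_derM (is_derB (is_derB (is_derB
    (is_derM (is_der_cst c2 t) (rec_b_der m t01)) (is_derM Dp Dp)) (is_derM Did Dp))
  (is_derM (is_der_cst c0 t) (is_der_id t))) (is_der_cst N^-1 t).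
apply: (derivable_pt_lim_local _ _ 0 1 t _ t01 pidotE); apply: (is_der_val D).
by rewrite /pid1 /db -/(T t) -/n -/(b t); ring.
Qed.

Lemma coef1_der2 t : in01 t -> is_der p1 t (p2 t).
Proof.
move=> t01; have T0 := T_neq0 t01.
have DT := is_derM (is_der_id t) (is_derB (is_der_cst 1 t) (is_der_id t)).
apply: (is_der_val (is_der_div (pidot_der t01) DT T0)).
rewrite /p2 /p1 -/(T t); move: T0; rewrite -/(T t) => T0.
have -> : 1 * (1 - t) + t * (0 - 1) = 1 - 2%:R * t by ring.
by field.
Qed.

(** [sigma_elimination] for the unknowns b eta_n and b eta_(n-1): b' gives their difference,
    [rec_b_eta] a second linear relation, [lax_det_t] their product. *)
Lemma coef1_ode t : in01 t ->
  let K := 2%:R * p t * p1 t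
    + (ga * (1 - 2%:R * t) + 2%:R * n%:R * (1 - t) + al * (1 - t) - be * t) * p1 t
    + c1 * p t + c0 in
  let G := p t ^+ 2 + (c1 * t - be) * p t + N * (T t * p1 t) + c0 * t in
  (T t * p2 t) ^+ 2 = K ^+ 2 - 4%:R * p1 t * (p1 t - ga) * G.
Proof.
move=> t01 K G; have [t0 t1] := t_neq0s t01; have T0 : T t != 0 := T_neq0 t01.
have pidT : pid t = T t * p1 t by rewrite /p1 mulrC divfK.
have eG : c2 * b t = G.
  rewrite /c2 /b [LHS](rec_b_coef1 (h_neq0 t01) (pearson_mom t01) m t0 t1).
  by rewrite -/n -/(p t) -/(pid t) pidT /G /c1 /c0 /N /n; ring.
have eS := rec_b_eta (h_neq0 t01) (pearson_mom t01) m t0 t1.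
have eT := lax_det_t (h_neq0 t01) (pearson_mom t01) m.
move: eS eT; rewrite -/n -/N -/(p t) -/(pid t) -/(T t) -/(b t).
set en := eta _ _ _ _ _ n; set em := eta _ _ _ _ _ m; rewrite pidT => eS eT.
apply: (sigma_elimination (a := b t * en) (b := b t * em) (c := b t) N_neq0 T0).
(* Differentiating [rec_b_coef1] gives (N^2 - 1) b' = K + N t (1-t) p'', and t (1-t) b' = b (eta_n -
   eta_(n-1)). *)
- have -> : T t * p2 t = pid1 t - (1 - 2%:R * t) * p1 t by rewrite /p2 mulrC divfK.
  have e1 : N * pid1 t = c2 * db t - 2%:R * p1 t * p t - c1 * p t - (c1 * t - be) * p1 t - c0.
    by rewrite /pid1 mulrC divfK.
  have e2 : T t * (c2 * db t) = c2 * (b t * en - b t * em).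
    by rewrite /db -/en -/em mulrCA [T t * _]mulrC divfK // -mulrBr.
  rewrite -e2; congr (_ * _).
  transitivity (K + N * pid1 t - N * ((1 - 2%:R * t) * p1 t)); last by ring.
  by rewrite e1 /K /N /c1 /c0 /n; ring.
- transitivity (b t * ((N + 1) * em + (N - 1) * en)); first by ring.
  by rewrite eS /K /c1 /c0 /T /n; ring.
- transitivity (b t * (b t * en * em)); first by ring.
  by rewrite -eT; ring.
- exact: eG.
Qed.
End Sigma.

End Moments.
End Deform.

(** * The determinant of moments and the equation for p_n over the real numbers *)

Module Bridge.
Import all_boot all_order all_algebra ring Rstruct.
Import GRing.Theory Num.Theory OrthoPoly Locality Deform.
Local Open Scope ring_scope.
Set Implicit Arguments.
Unset Strict Implicit.
Unset Printing Implicit Defensive.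

Lemma detn_det n (M : nat -> nat -> R) : detn n M = \det (\matrix_(i < n, j < n) M i j).
Proof.
elim: n M => [|n IH] M; first by rewrite det_mx00.
rewrite (expand_det_row _ ord0) /= sum_f_R0E big_mkord; apply: eq_bigr => j _.
rewrite /cofactor mxE add0n IH RpowE mulrCA mulrA; congr (_ * _ * \det _).
apply/matrixP => i k; rewrite !mxE; congr (M _ _).
(* Skipping column j in the definition of [detn] is the map [bump j] of the cofactor expansion. *)
by rewrite /= /bump; case: (Nat.ltb_spec k j) => /leP; rewrite ?ltnNge; [move=> /negPf-> | move=> ->].
Qed.

(** Positive definiteness of the Hankel form; it makes every h_n positive. *)
Definition positive_moments (mu : nat -> R) :=
  forall G : {poly R}, G != 0 -> Rlt 0 (mom_fun mu (G * G)).

Lemma positive_sqnorm mu n : positive_moments mu -> Rlt 0 (sqnorm mu n).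
Proof. by move=> pos; apply: pos; rewrite -size_poly_eq0 size_orthop. Qed.

Local Close Scope ring_scope.
Local Open Scope R_scope.

(** Any positive definite family of moments with the Pearson recurrence and the matching
    t-derivatives will do; the weight enters only through these. The witness p is [coef1] at n. *)
Theorem hankel_sigma (al be ga : R) (mu dmu : R -> nat -> R) (n : nat) :
  le 1 n -> 2 * INR n + (al + be + ga) <> 0 ->
  (forall t, in01 t -> forall k,
    - (INR k + 3 + (al + be + ga)) * mu t (S (S k))
    + (INR k * (1 + t) + ((al + 1) * (1 + t) + (be + 1) * t + (ga + 1))) * mu t (S k)
    - t * (INR k + al + 1) * mu t k = 0) ->
  (forall t, in01 t -> forall k, derivable_pt_lim (fun s => mu s k) t (dmu t k)) ->
  (forall t, in01 t -> forall k,
    t * (1 - t) * dmu t k = (INR k + 1 + al + ga * (1 - t)) * mu t k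
     - (INR k + 2 + (al + be + ga)) * mu t (S k)) ->
  (forall t, in01 t -> positive_moments (mu t)) ->
  let D t := detn n (fun i j => mu t (Nat.add i j)) in
  let N := 2 * INR n + (al + be + ga) in
  exists p p1 p2 : R -> R, forall t, in01 t ->
    0 < D t /\
    derivable_pt_lim D t ((INR n ^ 2 + INR n * (al + ga * (1 - t)) + N * p t)
      / (t * (1 - t)) * D t) /\
    derivable_pt_lim p t (p1 t) /\ derivable_pt_lim p1 t (p2 t) /\
    let K := 2 * p t * p1 t
      + (ga * (1 - 2 * t) + 2 * INR n * (1 - t) + al * (1 - t) - be * t) * p1 t
      + (2 * INR n + al + be) * p t + (INR n ^ 2 + al * INR n) in
    let G := p t ^ 2 + ((2 * INR n + al + be) * t - be) * p t + N * (t * (1 - t) * p1 t)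
      + (INR n ^ 2 + al * INR n) * t in
    (t * (1 - t) * p2 t) ^ 2 = K ^ 2 - 4 * p1 t * (p1 t - ga) * G.
Proof.
Local Open Scope ring_scope.
have I2 : IZR 2 = 2%:R by rewrite -INRE.
have I3 : IZR 3 = 3%:R by rewrite -INRE INR_IZR_INZ.
have I4 : IZR 4 = 4%:R by rewrite -INRE INR_IZR_INZ.
have toE := (RplusE, RminusE, RmultE, RoppE, RdivE, RpowE, INRE, R1E, R0E, I2, I3, I4).
case: n => [/leP//|m] _ N0 Hpear Hder Hdmu Hpos D N.
have h0 t : in01 t -> forall n, sqnorm (mu t) n != 0.
  by move=> t01 n; apply/eqP => E; have := positive_sqnorm n (Hpos t t01); rewrite E; apply: Rlt_irrefl.
have pear t : in01 t -> forall k,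
  - (k%:R + 3%:R + (al + be + ga)) * mu t k.+2
  + (k%:R * (1 + t) + pearson_mid al be ga t) * mu t k.+1
  - t * (k%:R + al + 1) * mu t k = 0.
  by move=> t01 k; have := Hpear t t01 k; rewrite !toE.
have dmuE t : in01 t -> forall k,
  t * (1 - t) * dmu t k = (k%:R + 1 + al + ga * (1 - t)) * mu t k
     - (k%:R + 2%:R + (al + be + ga)) * mu t k.+1.
  by move=> t01 k; have := Hdmu t t01 k; rewrite !toE.
have N0' : 2%:R * m.+1%:R + (al + be + ga) != 0.
  by apply/eqP => E; apply: N0; rewrite !toE.
have DE t : in01 t -> \prod_(k < m.+1) sqnorm (mu t) k = D t.
  by move=> t01; rewrite /D detn_det -(hankel_det (h0 t t01)).
exists (fun t => coef1 (mu t) m.+1); eexists; eexists => t t01.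
split; last split; last split; last split.
- rewrite -DE //; apply/RltP; apply: prodr_gt0 => k _; apply/RltP.
  exact: positive_sqnorm (Hpos t t01).
- have D0 := prod_sqnorm_der Hder dmuE h0 m.+1 t01.
  have := derivable_pt_lim_local _ D 0 1 t _ t01 DE D0.
  by rewrite DE // /N !toE.
- exact: (coef1_der1 Hder dmuE h0).
- exact: (coef1_der2 pear Hder dmuE h0 N0').
- have := coef1_ode pear h0 N0' t01.
  by rewrite /N !toE.
Qed.
End Bridge.

(** * Moments of the weight *)

Module Weight.
Import Coquelicot.

Lemma rpow_pos x a : 0 < x -> rpow x a = Rpower x a.
Proof. intros; unfold rpow; destruct (Rlt_dec 0 x); lra. Qed.
Lemma rpow_npos x a : x <= 0 -> rpow x a = 0.
Proof. intros; unfold rpow; destruct (Rlt_dec 0 x); lra. Qed.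
Lemma rpow_gt0 x a : 0 < x -> 0 < rpow x a.
Proof. intros; rewrite rpow_pos by lra; apply exp_pos. Qed.
Lemma rpow_ge0 x a : 0 <= rpow x a.
Proof.
destruct (Rlt_le_dec 0 x); [apply Rlt_le, rpow_gt0; lra | rewrite rpow_npos; lra].
Qed.

Lemma is_derive_Rpower x a : 0 < x -> is_derive (fun y => Rpower y a) x (a * Rpower x a / x).
Proof.
intros hx; unfold Rpower; auto_derive; [lra | field; lra].
Qed.

Lemma locally_pos x : 0 < x -> locally x (fun y => 0 < y).
Proof. intros hx; exact (open_gt 0 x hx). Qed.
Lemma locally_neg x : x < 0 -> locally x (fun y => y < 0).
Proof. intros hx; exact (open_lt 0 x hx). Qed.

Lemma rpow_small a eps : 0 < a -> 0 < eps ->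
  exists d : posreal, forall x, Rabs x < d -> Rabs (rpow x a) < eps.
Proof.
(* The radius eps^(1/a) is where x^a reaches eps. *)
intros ha he; exists (mkposreal (Rpower eps (/ a)) (exp_pos _)); simpl; intros x hx.
rewrite Rabs_pos_eq by apply rpow_ge0.
destruct (Rlt_le_dec 0 x) as [h|h]; [| rewrite rpow_npos; lra].
rewrite Rabs_pos_eq in hx by lra; rewrite rpow_pos by lra.
replace eps with (Rpower (Rpower eps (/ a)) a).
- unfold Rpower at 1 2; apply exp_increasing, Rmult_lt_compat_l, ln_increasing; lra.
- rewrite Rpower_mult; replace (/ a * a) with 1 by (field; lra); apply Rpower_1; lra.
Qed.

Lemma continuous_rpow a x : 0 < a -> continuous (fun y => rpow y a) x.
Proof.
intros ha; destruct (total_order_T x 0) as [[h|h]|h].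
- apply (continuous_ext_loc _ (fun _ => 0)); [| apply continuous_const].
  apply (filter_imp (fun y => y < 0)); [| now apply locally_neg].
  intros y hy; rewrite rpow_npos; lra.
- subst x; apply continuity_pt_filterlim; intros eps heps.
  destruct (rpow_small a eps ha heps) as [d hd]; exists d; split; [apply cond_pos|].
  intros y [_ hy]; simpl in *; unfold R_dist in *.
  rewrite (rpow_npos 0) by lra; rewrite Rminus_0_r in *; now apply hd.
- apply (continuous_ext_loc _ (fun y => Rpower y a)).
  + apply (filter_imp (fun y => 0 < y)); [| now apply locally_pos].
    intros y hy; rewrite rpow_pos; lra.
  + apply (ex_derive_continuous (V := R_NormedModule)).
    exists (a * Rpower x a / x); now apply is_derive_Rpower.
Qed.

(** The extra factor y makes the product differentiable at 0 too: the difference quotient there is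
    [rpow y a], which tends to 0. *)
Lemma is_derive_mul_rpow a x : 0 < a ->
  is_derive (fun y => y * rpow y a) x ((a + 1) * rpow x a).
Proof.
intros ha; destruct (total_order_T x 0) as [[h|h]|h].
- rewrite rpow_npos by lra; rewrite Rmult_0_r.
  apply (is_derive_ext_loc (fun _ => 0)); [| exact (is_derive_const (V := R_NormedModule) 0 x)].
  apply (filter_imp (fun y => y < 0)); [| now apply locally_neg].
  intros y hy; rewrite rpow_npos; lra.
- subst x; apply is_derive_Reals; intros eps heps.
  destruct (rpow_small a eps ha heps) as [d hd]; exists d; intros y y0 hy.
  rewrite (rpow_npos 0) by lra; rewrite Rplus_0_l.
  replace ((y * rpow y a - 0 * 0) / y - (a + 1) * 0) with (rpow y a) by (field; lra).
  now apply hd.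
- rewrite rpow_pos by lra.
  apply (is_derive_ext_loc (fun y => y * Rpower y a)).
  + apply (filter_imp (fun y => 0 < y)); [| now apply locally_pos].
    intros y hy; rewrite rpow_pos; lra.
  + replace ((a + 1) * Rpower x a) with (1 * Rpower x a + x * (a * Rpower x a / x)) by (field; lra).
    apply (is_derive_mult (fun y : R => y) (fun y => Rpower y a));
      [exact (is_derive_id (K := R_AbsRing) x) | now apply is_derive_Rpower | intros; apply Rmult_comm].
Qed.

Lemma is_derive_pow_mul_rpow k a x : 0 < a ->
  is_derive (fun y => y ^ k * (y * rpow y a)) x ((INR k + a + 1) * (x ^ k * rpow x a)).
Proof.
intros ha.
replace ((INR k + a + 1) * (x ^ k * rpow x a)) with
  (INR k * x ^ pred k * (x * rpow x a) + x ^ k * ((a + 1) * rpow x a)).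
- apply (is_derive_mult (fun y => y ^ k) (fun y => y * rpow y a));
    [| now apply is_derive_mul_rpow | intros; apply Rmult_comm].
  apply is_derive_Reals, derivable_pt_lim_pow.
(* For k = 0 the value [pred 0 = 0] is harmless, its term carrying the factor [INR 0]. *)
- destruct k as [|k]; [simpl; ring | rewrite <- tech_pow_Rmult; simpl pred; ring].
Qed.

(* |y|^c (A + B theta(y)), decoupled into its two half-lines. *)
Definition jump (A B c y : R) := (A + B) * rpow y c + A * rpow (- y) c.

Lemma weightE al be ga A B t x :
  weight al be ga A B t x = rpow x al * rpow (1 - x) be * jump A B ga (x - t).
Proof.
unfold weight, jump; rewrite Rmult_assoc; f_equal; set (y := x - t).
unfold theta; destruct (Rlt_dec 0 y) as [h|h].
- rewrite Rabs_pos_eq, (rpow_npos (- y)) by lra; ring.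
- rewrite Rabs_left1, (rpow_npos y) by lra; ring.
Qed.

Lemma continuous_jump A B c y : 0 < c -> continuous (jump A B c) y.
Proof.
intros hc; apply (continuous_plus (fun y => (A + B) * rpow y c) (fun y => A * rpow (- y) c)).
- apply (continuous_scal_r (A + B) (fun y => rpow y c)); now apply continuous_rpow.
- apply (continuous_scal_r A (fun y => rpow (- y) c)).
  apply (continuous_comp Ropp (fun y => rpow y c)); [| now apply continuous_rpow].
  apply (continuous_opp (fun y : R => y)), continuous_id.
Qed.

Lemma is_derive_mul_jump A B c y : 0 < c ->
  is_derive (fun z => z * jump A B c z) y ((c + 1) * jump A B c y).
Proof.
intros hc.
apply (is_derive_ext (fun z => (A + B) * (z * rpow z c) + - A * ((- z) * rpow (- z) c))).
{ intros z; unfold jump; simpl; ring. }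
replace ((c + 1) * jump A B c y) with
  ((A + B) * ((c + 1) * rpow y c) + - A * (-1 * ((c + 1) * rpow (- y) c)))
  by (unfold jump; ring).
apply (is_derive_plus (fun z => (A + B) * (z * rpow z c)) (fun z => - A * ((- z) * rpow (- z) c))).
- apply is_derive_scal; now apply is_derive_mul_rpow.
- apply is_derive_scal.
  apply (is_derive_comp (fun z => z * rpow z c) Ropp); [now apply is_derive_mul_rpow|].
  auto_derive; [easy | ring].
Qed.

Section Moments.
Variables al be ga A B : R.
Hypotheses (ha : 0 < al) (hb : 0 < be) (hg : 0 < ga).

Let w t x := rpow x al * rpow (1 - x) be * jump A B ga (x - t).

Lemma continuous_one_sub_rpow x : continuous (fun y => rpow (1 - y) be) x.
Proof.
apply (continuous_comp (fun y => 1 - y) (fun y => rpow y be)); [| now apply continuous_rpow].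
apply (continuous_minus (fun _ : R => 1) (fun y : R => y)); [apply continuous_const | apply continuous_id].
Qed.

Lemma continuous_ends x : continuous (fun y => rpow y al * rpow (1 - y) be) x.
Proof.
apply (continuous_mult (fun y => rpow y al) (fun y => rpow (1 - y) be));
  [now apply continuous_rpow | apply continuous_one_sub_rpow].
Qed.

Lemma continuous_weight t x : continuous (w t) x.
Proof.
unfold w.
apply (continuous_mult (fun y => rpow y al * rpow (1 - y) be) (fun y => jump A B ga (y - t)));
  [apply continuous_ends|].
apply (continuous_comp (fun y => y - t) (jump A B ga)); [| now apply continuous_jump].
apply (continuous_minus (fun y : R => y) (fun _ : R => t)); [apply continuous_id | apply continuous_const].
Qed.

Lemma continuous_pow k x : continuous (fun y => y ^ k) x.
Proof.
apply (ex_derive_continuous (V := R_NormedModule)); eexists.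
apply is_derive_Reals, derivable_pt_lim_pow.
Qed.

Lemma continuous_pow_weight t k x : continuous (fun y => y ^ k * w t y) x.
Proof.
apply (continuous_mult (fun y => y ^ k) (w t)); [apply continuous_pow | apply continuous_weight].
Qed.

Definition mu t k := RInt (fun x => x ^ k * w t x) 0 1.

Lemma is_RInt_mu t k : is_RInt (fun x => x ^ k * w t x) 0 1 (mu t k).
Proof.
apply (RInt_correct (V := R_CompleteNormedModule)), (ex_RInt_continuous (V := R_CompleteNormedModule)).
intros; apply continuous_pow_weight.
Qed.

Lemma is_RInt_lin (f g : R -> R) (u v lf lg : R) : is_RInt f 0 1 lf -> is_RInt g 0 1 lg ->
  is_RInt (fun x => u * f x + v * g x) 0 1 (u * lf + v * lg).
Proof.
intros hf hg'.
apply (is_RInt_plus (V := R_NormedModule) (fun x => u * f x) (fun x => v * g x)).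
- now apply (is_RInt_scal (V := R_NormedModule)).
- now apply (is_RInt_scal (V := R_NormedModule)).
Qed.

(** The integral over [0,1] of the derivative of x^(k+1) (1-x) (x-t) w, a function that vanishes at
    both ends. *)
Lemma moment_pearson t k :
  - (INR k + 3 + (al + be + ga)) * mu t (S (S k))
  + (INR k * (1 + t) + ((al + 1) * (1 + t) + (be + 1) * t + (ga + 1))) * mu t (S k)
  - t * (INR k + al + 1) * mu t k = 0.
Proof.
set (c2 := - (INR k + 3 + (al + be + ga))).
set (c1 := INR k * (1 + t) + _).
(* Each power is grouped with its own linear factor, so that F is differentiable also at 0, 1 and t,
   where w need not be. *)
set (F := fun x => (x ^ k * (x * rpow x al)) * ((1 - x) * rpow (1 - x) be)
   * ((x - t) * jump A B ga (x - t))).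
set (dF := fun x => 1 * (c2 * (x ^ S (S k) * w t x) + c1 * (x ^ S k * w t x))
   + (- (t * (INR k + al + 1))) * (x ^ k * w t x)).
assert (I1 : is_RInt dF 0 1 (1 * (c2 * mu t (S (S k)) + c1 * mu t (S k))
   + (- (t * (INR k + al + 1))) * mu t k)).
{ apply (is_RInt_lin (fun x => c2 * (x ^ S (S k) * w t x) + c1 * (x ^ S k * w t x))).
  - apply is_RInt_lin; apply is_RInt_mu.
  - apply is_RInt_mu. }
assert (I2 : is_RInt dF 0 1 (F 1 - F 0)).
{ apply (is_RInt_derive (V := R_CompleteNormedModule) F).
  - intros x _.
    replace (dF x) with
     ((((INR k + al + 1) * (x ^ k * rpow x al)) * ((1 - x) * rpow (1 - x) be)
       + (x ^ k * (x * rpow x al)) * (-1 * ((be + 1) * rpow (1 - x) be)))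
       * ((x - t) * jump A B ga (x - t))
      + (x ^ k * (x * rpow x al)) * ((1 - x) * rpow (1 - x) be)
       * (1 * ((ga + 1) * jump A B ga (x - t)))).
    2: { unfold dF, c1, c2, w; simpl; ring. }
    apply (is_derive_mult (fun x => (x ^ k * (x * rpow x al)) * ((1 - x) * rpow (1 - x) be))
       (fun x => (x - t) * jump A B ga (x - t))); [| | intros; apply Rmult_comm].
    + apply (is_derive_mult (fun x => x ^ k * (x * rpow x al)) (fun x => (1 - x) * rpow (1 - x) be));
        [now apply is_derive_pow_mul_rpow | | intros; apply Rmult_comm].
      apply (is_derive_comp (fun z => z * rpow z be) (fun x => 1 - x));
        [now apply is_derive_mul_rpow | auto_derive; [easy | ring]].
    + apply (is_derive_comp (fun z => z * jump A B ga z) (fun x => x - t));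
        [now apply is_derive_mul_jump | auto_derive; [easy | ring]].
  - intros x _; unfold dF.
    apply (continuous_plus (fun x => 1 * (c2 * (x ^ S (S k) * w t x) + c1 * (x ^ S k * w t x)))
       (fun x => - (t * (INR k + al + 1)) * (x ^ k * w t x))).
    + apply (continuous_scal_r 1 (fun x => c2 * (x ^ S (S k) * w t x) + c1 * (x ^ S k * w t x))).
      apply (continuous_plus (fun x => c2 * (x ^ S (S k) * w t x)) (fun x => c1 * (x ^ S k * w t x))).
      * apply (continuous_scal_r c2 (fun x => x ^ S (S k) * w t x)), continuous_pow_weight.
      * apply (continuous_scal_r c1 (fun x => x ^ S k * w t x)), continuous_pow_weight.
    + apply (continuous_scal_r (- (t * (INR k + al + 1))) (fun x => x ^ k * w t x)), continuous_pow_weight. }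
apply (is_RInt_unique (V := R_CompleteNormedModule)) in I1.
apply (is_RInt_unique (V := R_CompleteNormedModule)) in I2.
rewrite I1 in I2; unfold F in I2; lra.
Qed.

(* Multiplying the weight by (x - t) raises the exponent of |x - t| by one, so
   that differentiation under the integral sign meets no singularity. *)
Lemma moment_shift_der t k :
  is_derive (fun s => mu s (S k) - s * mu s k) t (- (ga + 1) * mu t k).
Proof.
set (g := fun x => x ^ k * (rpow x al * rpow (1 - x) be)).
set (f := fun s x => g x * ((x - s) * jump A B ga (x - s))).
assert (cg : forall x, continuous g x).
{ intros x; apply (continuous_mult (fun y => y ^ k) (fun y => rpow y al * rpow (1 - y) be));
   [apply continuous_pow | apply continuous_ends]. }
assert (Df : forall s x, is_derive (fun u => f u x) s (- (ga + 1) * (x ^ k * w s x))).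
{ intros s x; unfold f.
  replace (- (ga + 1) * (x ^ k * w s x)) with (g x * (-1 * ((ga + 1) * jump A B ga (x - s))))
    by (unfold g, w; ring).
  apply is_derive_scal.
  apply (is_derive_comp (fun z => z * jump A B ga z) (fun u => x - u));
    [now apply is_derive_mul_jump | auto_derive; [easy | ring]]. }
assert (I : forall s, is_RInt (f s) 0 1 (mu s (S k) - s * mu s k)).
{ intros s; replace (mu s (S k) - s * mu s k) with (1 * mu s (S k) + (- s) * mu s k) by ring.
  apply (is_RInt_ext (V := R_NormedModule) (fun x => 1 * (x ^ S k * w s x) + (- s) * (x ^ k * w s x))).
  - intros x _; unfold f, g, w; simpl; ring.
  - apply is_RInt_lin; apply is_RInt_mu. }
apply (is_derive_ext (fun s => RInt (f s) 0 1)).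
{ intros s; apply (is_RInt_unique (V := R_CompleteNormedModule)), I. }
replace (- (ga + 1) * mu t k) with (RInt (fun x => Derive (fun u => f u x) t) 0 1).
- apply is_derive_RInt_param.
  + apply filter_forall; intros s x _; eexists; apply Df.
  + intros x _.
    apply (continuity_2d_pt_ext (fun u v => - (ga + 1) * g v * jump A B ga (v - u))).
    { intros u v; symmetry; etransitivity; [apply is_derive_unique, Df | unfold g, w; ring]. }
    apply continuity_2d_pt_mult.
    * apply (continuity_1d_2d_pt_comp (fun v => - (ga + 1) * g v) (fun _ v => v));
        [| apply continuity_2d_pt_id2].
      apply continuity_pt_filterlim.
      apply (continuous_scal_r (- (ga + 1)) g), cg.
    * apply (continuity_1d_2d_pt_comp (jump A B ga) (fun u v => v - u)).
      { apply continuity_pt_filterlim; now apply continuous_jump. }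
      apply continuity_2d_pt_minus; [apply continuity_2d_pt_id2 | apply continuity_2d_pt_id1].
  + apply filter_forall; intros s; eexists; apply I.
- apply (is_RInt_unique (V := R_CompleteNormedModule)).
  apply (is_RInt_ext (V := R_NormedModule) (fun x => - (ga + 1) * (x ^ k * w t x))).
  + intros x _; symmetry; apply is_derive_unique, Df.
  + apply (is_RInt_scal (V := R_NormedModule)), is_RInt_mu.
Qed.

Definition dmu t k :=
  ((INR k + 1 + al + ga * (1 - t)) * mu t k - (INR k + 2 + (al + be + ga)) * mu t (S k))
  / (t * (1 - t)).

(** By [moment_shift_der] the combinations nu_j = mu_(j+1) - s mu_j are differentiable. The Pearson
    recurrence expresses (ga+1) s (1-s) mu_k through nu_k and nu_(k+1), so mu_k is differentiable on
    (0,1). *)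
Lemma moment_der t k : 0 < t < 1 -> is_derive (fun s => mu s k) t (dmu t k).
Proof.
intros ht; set (nu := fun j s => mu s (S j) - s * mu s j).
assert (Dnu : forall j, is_derive (nu j) t (- (ga + 1) * mu t j))
  by (intros j; apply moment_shift_der).
set (f := fun s => - (((ga + 1) * (1 - s) + INR k + al + 1) * nu k s
   - (INR k + 3 + (al + be + ga)) * nu (S k) s)).
set (T := fun s => (ga + 1) * (s * (1 - s))).
assert (HT : forall s, 0 < s < 1 -> T s <> 0).
{ intros s hs; unfold T; assert (0 < (ga + 1) * (s * (1 - s))) by (repeat apply Rmult_lt_0_compat; lra); lra. }
assert (E : forall s, 0 < s < 1 -> f s / T s = mu s k).
{ intros s hs; pose proof (moment_pearson s k) as P; specialize (HT s hs).
  replace (f s) with (T s * mu s k); [field; exact HT|].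
  unfold f, T, nu; nra. }
apply (is_derive_ext_loc (fun s => f s / T s)).
{ assert (d0 : 0 < Rmin t (1 - t)) by (apply Rmin_pos; lra).
  exists (mkposreal _ d0); intros s Hs; apply E.
  unfold ball in Hs; simpl in Hs; unfold AbsRing_ball, abs, minus, plus, opp in Hs; simpl in Hs.
  apply Rabs_lt_between in Hs.
  pose proof (Rmin_l t (1 - t)); pose proof (Rmin_r t (1 - t)); lra. }
assert (Df : is_derive f t (- ((- (ga + 1)) * nu k t
   + ((ga + 1) * (1 - t) + INR k + al + 1) * (- (ga + 1) * mu t k)
   - (INR k + 3 + (al + be + ga)) * (- (ga + 1) * mu t (S k))))).
{ unfold f; apply (is_derive_opp (V := R_NormedModule)).
  apply (is_derive_minus (V := R_NormedModule)).
  - apply (is_derive_mult (fun s => (ga + 1) * (1 - s) + INR k + al + 1) (nu k));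
      [auto_derive; [easy | ring] | apply Dnu | intros; apply Rmult_comm].
  - apply is_derive_scal, Dnu. }
assert (DT : is_derive T t ((ga + 1) * (1 - 2 * t))).
{ unfold T; auto_derive; [easy | ring]. }
pose proof (is_derive_div f T t _ _ Df DT (HT t ht)) as D.
replace (dmu t k) with (((- ((- (ga + 1)) * nu k t
   + ((ga + 1) * (1 - t) + INR k + al + 1) * (- (ga + 1) * mu t k)
   - (INR k + 3 + (al + be + ga)) * (- (ga + 1) * mu t (S k)))) * T t
   - f t * ((ga + 1) * (1 - 2 * t))) / T t ^ 2); [exact D|].
replace (f t) with (T t * mu t k) by (rewrite <- (E t ht); field; now apply HT).
unfold dmu, T, nu; field; split; [lra | split; lra].
Qed.

End Moments.
End Weight.

(** * Positivity of integrals and of the weight *)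

Module Positivity.
Import Coquelicot Weight.

(** By continuity f is positive on an interval around x0; the two outer pieces contribute
    nonnegative amounts. *)
Lemma RInt_continuous_pos (f : R -> R) x0 : (forall x, continuous f x) ->
  (forall x, 0 < x < 1 -> 0 <= f x) -> 0 < x0 < 1 -> 0 < f x0 -> 0 < RInt f 0 1.
Proof.
intros cf f0 hx fx.
assert (ef : forall a b, ex_RInt f a b)
  by (intros a b; apply (ex_RInt_continuous (V := R_CompleteNormedModule)); intros; apply cf).
assert (L : locally x0 (fun y => 0 < f y)) by exact (cf x0 _ (locally_pos _ fx)).
destruct L as [eps he].
set (d := Rmin eps (Rmin x0 (1 - x0)) / 2).
assert (hd : 0 < d /\ d < eps /\ d < x0 /\ d < 1 - x0).
{ pose proof (cond_pos eps); pose proof (Rmin_l eps (Rmin x0 (1 - x0)));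
  pose proof (Rmin_r eps (Rmin x0 (1 - x0))); pose proof (Rmin_l x0 (1 - x0));
  pose proof (Rmin_r x0 (1 - x0)).
  assert (0 < Rmin eps (Rmin x0 (1 - x0))) by (repeat apply Rmin_pos; lra).
  unfold d; lra. }
rewrite <- (RInt_Chasles f 0 (x0 - d) 1) by apply ef.
rewrite <- (RInt_Chasles f (x0 - d) (x0 + d) 1) by apply ef.
assert (0 <= RInt f 0 (x0 - d)) by (apply RInt_ge_0; [lra | apply ef | intros; apply f0; lra]).
assert (0 <= RInt f (x0 + d) 1) by (apply RInt_ge_0; [lra | apply ef | intros; apply f0; lra]).
assert (0 < RInt f (x0 - d) (x0 + d)).
{ apply RInt_gt_0; [lra | | intros; apply cf].
  intros x hx'; apply he; unfold ball; simpl; unfold AbsRing_ball, abs, minus, plus, opp; simpl.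
  apply Rabs_def1; lra. }
unfold plus; simpl; lra.
Qed.

(** The chosen value is independent of the choice, since every integrability proof yields the same
    [RiemannInt]. *)
Lemma integral01_RInt (f : R -> R) (I : R) : is_RInt f 0 1 I -> integral01 f = I.
Proof.
intros hf; assert (ef : ex_RInt f 0 1) by (exists I; exact hf).
rewrite <- (is_RInt_unique f 0 1 I hf).
unfold integral01; destruct (excluded_middle_informative _) as [h|h].
- destruct (constructive_indefinite_description _ h) as [J [pr HJ]]; simpl.
  rewrite <- HJ; symmetry; apply RInt_Reals.
- exfalso; apply h; exists (RInt f 0 1), (ex_RInt_Reals_0 _ _ _ ef); symmetry; apply RInt_Reals.
Qed.

(** A sequence of distinct points of (a,b); the shift by 2 keeps the first one strictly below b. *)
Definition spread (a b : R) (i : nat) := a + (b - a) / INR (S (S i)).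

Lemma spread_in a b i : a < b -> a < spread a b i < b.
Proof.
intros ab; unfold spread; set (q := (b - a) / INR (S (S i))).
assert (h : INR (S (S i)) >= 2) by (rewrite !S_INR; pose proof (pos_INR i); lra).
assert (e : q * INR (S (S i)) = b - a) by (unfold q; field; lra).
assert (0 < q) by (unfold q; apply Rdiv_lt_0_compat; lra).
split; nra.
Qed.

Lemma spread_inj a b i j : a < b -> spread a b i = spread a b j -> i = j.
Proof.
intros ab; unfold spread; intros e.
assert (hi : INR (S (S i)) >= 2) by (rewrite !S_INR; pose proof (pos_INR i); lra).
assert (hj : INR (S (S j)) >= 2) by (rewrite !S_INR; pose proof (pos_INR j); lra).
assert (e' : (b - a) * INR (S (S j)) = (b - a) * INR (S (S i))).
{ apply Rplus_eq_reg_l in e.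
  replace ((b - a) * INR (S (S j))) with ((b - a) / INR (S (S i)) * INR (S (S i)) * INR (S (S j)))
    by (field; lra).
  rewrite e; field; lra. }
apply Rmult_eq_reg_l in e'; [| lra].
now apply INR_eq in e'; injection e'.
Qed.

Section PositiveWeight.
Variables al be ga A B : R.
Hypotheses (ha : 0 < al) (hb : 0 < be) (hg : 0 < ga).
Hypotheses (hA : 0 <= A) (hAB : 0 <= A + B) (hnz : ~ (A = 0 /\ A + B = 0)).

Lemma jump_ge0 y : 0 <= jump A B ga y.
Proof.
unfold jump; pose proof (rpow_ge0 y ga); pose proof (rpow_ge0 (- y) ga).
apply Rplus_le_le_0_compat; apply Rmult_le_pos; assumption.
Qed.

Lemma weight_ge0 t x : 0 <= weight al be ga A B t x.
Proof.
rewrite weightE; apply Rmult_le_pos; [apply Rmult_le_pos; apply rpow_ge0 | apply jump_ge0].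
Qed.

(** The mass may lie on one side of t only: (0,t) serves if A > 0; otherwise A = 0, A + B > 0 and
    (t,1) serves. *)
Lemma weight_gt0 t : 0 < t < 1 -> exists a b, 0 <= a /\ a < b /\ b <= 1 /\
  forall x, a < x < b -> 0 < weight al be ga A B t x.
Proof.
intros ht; destruct (Rlt_le_dec 0 A) as [h|h].
- exists 0, t; repeat split; try lra; intros x hx.
  rewrite weightE; unfold jump.
  rewrite (rpow_npos (x - t)) by lra; rewrite Rmult_0_r, Rplus_0_l.
  repeat apply Rmult_lt_0_compat; try (apply rpow_gt0; lra); lra.
- assert (A + B <> 0) by (intro; apply hnz; split; lra).
  exists t, 1; repeat split; try lra; intros x hx.
  rewrite weightE; unfold jump.
  rewrite (rpow_npos (- (x - t))) by lra; rewrite Rmult_0_r, Rplus_0_r.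
  repeat apply Rmult_lt_0_compat; try (apply rpow_gt0; lra); lra.
Qed.

Lemma is_RInt_moment t k :
  is_RInt (fun x => x ^ k * weight al be ga A B t x) 0 1 (mu al be ga A B t k).
Proof.
apply (is_RInt_ext (fun x => x ^ k * (rpow x al * rpow (1 - x) be * jump A B ga (x - t)))).
- intros x _; now rewrite weightE.
- now apply is_RInt_mu.
Qed.

Lemma continuous_defs_weight t x : continuous (weight al be ga A B t) x.
Proof.
apply (continuous_ext (fun x => rpow x al * rpow (1 - x) be * jump A B ga (x - t))).
- intros y; now rewrite weightE.
- now apply continuous_weight.
Qed.

Lemma momentE t k : moment al be ga A B t k = mu al be ga A B t k.
Proof. apply integral01_RInt, is_RInt_moment. Qed.

End PositiveWeight.
End Positivity.

(** * Positive definiteness of the moments of the weight *)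

Module PolyIntegral.
Import all_boot all_order all_algebra ring Rstruct.
Import GRing.Theory Num.Theory OrthoPoly Locality Deform Bridge.
Import Coquelicot.RInt Coquelicot.Hierarchy Coquelicot.Continuity Weight Positivity.
Local Open Scope ring_scope.

(** A nonzero G has fewer than [size G] roots, so one of [size G] distinct points of (a,b) is not a
    root. *)
Lemma poly_nonroot (G : {poly R}) (a b : R) : G != 0 -> Rlt a b ->
  exists x, [/\ Rlt a x, Rlt x b & G.[x] != 0].
Proof.
move=> G0 ab.
pose s := [seq spread a b i | i <- seq.iota 0%N (size G)].
case: (boolP (seq.all (root G) s)) => [rs|/allPn[y]].
  have us : uniq s by rewrite map_inj_uniq ?iota_uniq // => i j; exact: spread_inj.
  by have := max_poly_roots G0 rs us; rewrite size_map size_iota ltnn.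
by case/mapP => i _ -> nr; exists (spread a b i); have [] := spread_in a b i ab.
Qed.

Section WeightedIntegral.
Variables al be ga A B : R.
Hypotheses (ha : Rlt 0 al) (hb : Rlt 0 be) (hg : Rlt 0 ga).

Lemma is_RInt_horner t (G : {poly R}) :
  is_RInt (fun x => G.[x] * weight al be ga A B t x) (IZR 0) (IZR 1)
    (mom_fun (Weight.mu al be ga A B t) G).
Proof.
elim/poly_ind_monomial: G => [|u k G IH].
  rewrite mom_fun0; apply: (@is_RInt_ext R_NormedModule (fun _ => 0)); last first.
    have := @is_RInt_const R_NormedModule (IZR 0) (IZR 1) 0.
    by rewrite /scal /= /mult /= Rmult_0_r.
  by move=> x _; rewrite horner0 mul0r.
rewrite mom_funD mom_funZ mom_funXn.
apply: (@is_RInt_ext R_NormedModule (fun x => Rplus (u * (pow x k * weight al be ga A B t x))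
   (G.[x] * weight al be ga A B t x))).
  move=> x _; move: (weight _ _ _ _ _ _ x) => W.
  by rewrite !RmultE RplusE RpowE hornerD hornerZ hornerXn; ring.
apply: (@is_RInt_plus R_NormedModule) => //.
by apply: (@is_RInt_scal R_NormedModule); exact: is_RInt_moment.
Qed.

Lemma continuous_horner (G : {poly R}) (x : R) : continuous (fun y : R => G.[y] : R) x.
Proof.
elim/poly_ind_monomial: G => [|u k G IH].
  apply: (@continuous_ext R_UniformSpace R_UniformSpace (fun _ : R => 0)); first by move=> y; rewrite horner0.
  exact: continuous_const.
apply: (@continuous_ext R_UniformSpace R_UniformSpace (fun y : R => Rplus (Rmult u (pow y k)) (G.[y]))).
  by move=> y; rewrite RplusE RpowE hornerD hornerZ hornerXn.
apply: (@continuous_plus R_UniformSpace _ R_NormedModule (fun y : R => Rmult u (pow y k))) => //.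
by apply: (@continuous_scal_r R_UniformSpace R_AbsRing R_NormedModule u (fun y : R => pow y k)); exact: continuous_pow.
Qed.

Hypotheses (hA : Rle 0 A) (hAB : Rle 0 (Rplus A B)) (hnz : ~ (A = IZR 0 /\ Rplus A B = IZR 0)).

(** The functional at G^2 is the integral of G^2 w, which is continuous, nonnegative, and positive
    at a nonroot of G inside an interval where w > 0. *)
Lemma weight_positive_moments t : in01 t -> positive_moments (Weight.mu al be ga A B t).
Proof.
move=> t01 G G0; rewrite -(is_RInt_unique _ _ _ _ (is_RInt_horner t (G * G))).
have [a [b [a0 [ab [b1 wpos]]]]] := weight_gt0 al be ga A B hA hAB hnz t t01.
have [x [ax xb Gx]] := poly_nonroot G a b G0 ab.
apply: (RInt_continuous_pos _ x).
- move=> y; apply: (@continuous_mult R_UniformSpace R_AbsRing (fun y : R => (G * G).[y] : R)); first exact: continuous_horner.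
  exact: continuous_defs_weight.
- move=> y _; rewrite hornerM; apply: Rmult_le_pos; last exact: weight_ge0.
  exact: Rle_0_sqr.
- split; first exact: (Rle_lt_trans _ a).
  exact: (Rlt_le_trans _ b).
- rewrite hornerM; apply: Rmult_lt_0_compat; last by apply: wpos.
  by apply: Rlt_0_sqr; apply/eqP.
Qed.
End WeightedIntegral.
End PolyIntegral.

(** * The sigma form for D_n *)

Import Coquelicot.Coquelicot Locality.

Theorem theorem3p3 (alpha beta gamma A B : R)
  (ha : 0 < alpha) (hb : 0 < beta) (hg : 0 < gamma)
  (hA : 0 <= A) (hAB : 0 <= A + B) (hnz : ~ (A = 0 /\ A + B = 0))
  (n : nat) (hn : (1 <= n)%nat) :
  exists L H1 H2 : R -> R,
    forall t : R, 0 < t < 1 ->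
      let D := Dn alpha beta gamma A B n in
      let H := fun s => s * (s - 1) * L s in
      let N := INR n in
      0 < D t /\
      derivable_pt_lim (fun s => ln (D s)) t (L t) /\
      derivable_pt_lim H t (H1 t) /\
      derivable_pt_lim H1 t (H2 t) /\
      t ^ 2 * (t - 1) ^ 2 * (H2 t) ^ 2 + 4 * t * (t - 1) * (H1 t) ^ 3
      - (4 * (2 * t - 1) * H t
         + (4 * N ^ 2 + 4 * N * (alpha + beta + gamma) + (alpha + beta) ^ 2) * t ^ 2
         - 2 * (2 * N ^ 2 + 2 * N * (alpha + beta + gamma) + alpha * (alpha + gamma)
                + beta * (alpha - gamma)) * t
         + (alpha + gamma) ^ 2) * (H1 t) ^ 2
      + 2 * (2 * (H t) ^ 2
             + ((4 * N ^ 2 + 4 * N * (alpha + beta + gamma) + (alpha + beta) ^ 2) * t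
                - 2 * N ^ 2 - 2 * N * (alpha + beta + gamma) - alpha * (alpha + gamma)
                - beta * (alpha - gamma)) * H t
             - N * gamma * (N + alpha + beta + gamma) * ((alpha - beta) * t - alpha - gamma))
        * H1 t
      - (4 * N ^ 2 + 4 * N * (alpha + beta + gamma) + (alpha + beta) ^ 2) * (H t) ^ 2
      + 2 * N * gamma * (alpha - beta) * (N + alpha + beta + gamma) * H t
      - N ^ 2 * gamma ^ 2 * (N + alpha + beta + gamma) ^ 2 = 0.
Proof.
set (s := alpha + beta + gamma); set (N' := 2 * INR n + s).
assert (hN : 1 <= INR n) by (apply (le_INR 1) in hn; exact hn).
assert (hN' : N' <> 0) by (unfold N', s; lra).
assert (Dmu : forall t, in01 t -> forall k, derivable_pt_lim
  (fun u => Weight.mu alpha beta gamma A B u k) t (Weight.dmu alpha beta gamma A B t k)).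
{ intros t ht k; apply is_derive_Reals, Weight.moment_der; assumption. }
assert (dmuE : forall t, in01 t -> forall k,
  t * (1 - t) * Weight.dmu alpha beta gamma A B t k
  = (INR k + 1 + alpha + gamma * (1 - t)) * Weight.mu alpha beta gamma A B t k
    - (INR k + 2 + (alpha + beta + gamma)) * Weight.mu alpha beta gamma A B t (S k)).
{ intros t ht k; unfold Weight.dmu; field; unfold in01 in ht; lra. }
destruct (@Bridge.hankel_sigma alpha beta gamma _ _ n hn hN'
  (fun t _ k => Weight.moment_pearson alpha beta gamma A B ha hb hg t k) Dmu dmuE
  (fun t ht => PolyIntegral.weight_positive_moments alpha beta gamma A B ha hb hg hA hAB hnz t ht))
  as (p & p1 & p2 & Hp).
fold s N' in Hp.
(* c is t (1-t) (ln D_n)', so H = t (t-1) (ln D_n)' is - c; the witnesses for H' and H'' are its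
   derivatives. *)
set (c := fun t => INR n ^ 2 + INR n * (alpha + gamma * (1 - t)) + N' * p t).
exists (fun t => c t / (t * (1 - t))), (fun t => INR n * gamma - N' * p1 t), (fun t => - (N' * p2 t)).
intros t ht D H N.
assert (DE : D = fun u => detn n (fun i j => Weight.mu alpha beta gamma A B u (i + j))).
{ unfold D, Dn; extensionality u; f_equal; extensionality i; extensionality j.
  apply Positivity.momentE; assumption. }
assert (HE : forall u, 0 < u < 1 -> - c u = H u).
{ intros u hu; unfold H; field; lra. }
destruct (Hp t ht) as (Dpos & DD & Dp & Dp1 & ode); cbv zeta in ode; rewrite DE.
repeat split.
- exact Dpos.
- replace (c t / (t * (1 - t))) with (/ detn n (fun i j => Weight.mu alpha beta gamma A B t (i + j))
    * (c t / (t * (1 - t)) * detn n (fun i j => Weight.mu alpha beta gamma A B t (i + j)))).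
  + apply (derivable_pt_lim_comp _ ln); [exact DD | now apply derivable_pt_lim_ln].
  + field; repeat split; lra.
- apply (derivable_pt_lim_local (fun u => - c u) H 0 1 t _ ht HE).
  apply is_derive_Reals in Dp; apply is_derive_Reals.
  apply (is_derive_ext (fun u => - (INR n ^ 2 + INR n * (alpha + gamma * (1 - u))) + - N' * p u));
    [intros u; unfold c; simpl; ring|].
  replace (INR n * gamma - N' * p1 t) with (INR n * gamma + - N' * p1 t) by ring.
  apply (is_derive_plus (V := R_NormedModule)).
  + auto_derive; [easy | ring].
  + now apply is_derive_scal.
- apply is_derive_Reals in Dp1; apply is_derive_Reals.
  apply (is_derive_ext (fun u => INR n * gamma + - N' * p1 u)); [intros u; simpl; ring|].
  replace (- (N' * p2 t)) with (0 + - N' * p2 t) by ring.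
  apply (is_derive_plus (V := R_NormedModule)).
  + exact (is_derive_const (V := R_NormedModule) (INR n * gamma) t).
  + now apply is_derive_scal.
- rewrite <- (HE t ht); unfold c.
  (* At H = - c the left side of the sigma form is N'^2 times the difference of the two sides of the
     equation for p. *)
  match type of ode with _ = ?r =>
    transitivity (N' ^ 2 * ((t * (1 - t) * p2 t) ^ 2 - r)) end.
  + unfold N', s, N; ring.
  + rewrite ode; ring.
Qed.
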